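(* Let $K$ be an algebraically closed field of characteristic $p>0$. Then: 1. The map $\mathrm{Max}(P_n)=K^n\to\widehat{\mathcal D(P_n)}(\text{fin. pres.})$, $\mathfrak m\mapsto[U(\mathfrak m):=\mathcal D(P_n)\otimes_{P_n}P_n/\mathfrak m]$, is a bijection with inverse $[M]\mapsto\mathrm{ass}_{P_n}(M)$. In particular, $\mathrm{ass}_{P_n}(U(\mathfrak m))=\{\mathfrak m\}$. 2. $\mathrm{End}_{\mathcal D(P_n)}(U(\mathfrak m))\simeq K$. 3. On the simple $\mathcal D(P_n)$-module $U(\mathfrak m)=\Lambda\otimes P_n/\mathfrak m=\Lambda\bar1$ consider the filtration $\{U(\mathfrak m)_i:=F_i\bar1=\bigoplus_{|\beta|\le i}K\partial^{[\beta]}\bar1\}$. Then (a) the Poincaré series $P_{U(\mathfrak m)}(\omega)=\sum_{i\ge0}\dim_K(U(\mathfrak m)_i)\omega^i=\frac1{(1-\omega)^{n+1}}$; (b) the multiplicity $e(U(\mathfrak m))=1$; (c) $\dim_K(U(\mathfrak m)_i)=\binom{i+n}{n}$ is a polynomial.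
   Context: $P_n=K[x_1,\dots,x_n]$, $n\ge1$; $\mathcal D(P_n)$ is the ring of $K$-linear differential operators on $P_n$; modules are left modules. For $j\ge0$ let $\partial_i^{[j]}=\frac{\partial_i^j}{j!}$ be the operator $x^\alpha\mapsto\binom{\alpha_i}{j}x^{\alpha-je_i}$ (zero if $j>\alpha_i$), $\partial^{[\beta]}=\prod_i\partial_i^{[\beta_i]}$. Then $\mathcal D(P_n)=\bigoplus_{\alpha,\beta\in\mathbb N^n}Kx^\alpha\partial^{[\beta]}$, $\Lambda:=\bigoplus_{\beta\in\mathbb N^n}K\partial^{[\beta]}$, and $F_i=\bigoplus_{|\alpha|+|\beta|\le i}Kx^\alpha\partial^{[\beta]}$ is the canonical filtration. $\widehat{\mathcal D(P_n)}(\text{fin. pres.})$ is the set of isomorphism classes of simple finitely presented $\mathcal D(P_n)$-modules; $\mathrm{Max}(P_n)$ is the set of maximal ideals of $P_n$; $\mathrm{ass}_{P_n}(M)$ is the set of associated primes of $M$ as a $P_n$-module; $\bar1=1\otimes(1+\mathfrak m)$. If $\dim_K(F_iM_0)=\frac{e}{n!}i^n+o(i^n)$ for a module $M=\mathcal D(P_n)M_0$ with $\dim_KM_0<\infty$, then $e(M):=e$ is the multiplicity of $M$ (independent of $M_0$). *)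

(* Defs.v *)
From HB Require Import structures.
From mathcomp Require Import all_boot all_order all_algebra.
From mathcomp Require Import boolp classical_sets functions.
From mathcomp Require Import mpoly freeg.

Set Implicit Arguments.
Unset Strict Implicit.
Unset Printing Implicit Defensive.

Import GRing.Theory Num.Theory.

Local Open Scope classical_set_scope.
Local Open Scope ring_scope.
Local Open Scope quotient_scope.

Section Span.
Variables (R : pzRingType) (V : lmodType R).

Definition span (X : set V) : set V :=
  [set v | exists (r : nat) (c : 'I_r -> R) (x : 'I_r -> V),
     (forall i, X (x i)) /\ v = \sum_(i < r) c i *: x i].

Definition span_pred (X : set V) : {pred V} := [pred v | `[< span X v >]].

Lemma span_predP (X : set V) v : reflect (span X v) (v \in span_pred X).
Proof. exact: asboolP. Qed.

Lemma span_submod_closed (X : set V) : submod_closed (span_pred X).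
Proof.
split=> [|a u v /span_predP[r [c [x [Xx ->]]]] /span_predP[s [d [y [Xy ->]]]]].
  by apply/span_predP; exists 0%N, (fun=> 0), (fun=> 0); split=> [[]|] //; rewrite big_ord0.
apply/span_predP; exists (r + s)%N.
exists (fun i => match fintype.split i with inl j => a * c j | inr j => d j end).
exists (fun i => match fintype.split i with inl j => x j | inr j => y j end).
split=> [i|]; first by case: (fintype.split i) => ?.
rewrite big_split_ord /= scaler_sumr; congr (_ + _); apply: eq_bigr => i _.
  by rewrite (unsplitK (inl _ i)) scalerA.
by rewrite (unsplitK (inr _ i)).
Qed.

HB.instance Definition _ (X : set V) :=
  GRing.isSubmodClosed.Build R V (span_pred X) (span_submod_closed X).

End Span.

Section Dimension.
Variables (R : pzRingType) (V : lmodType R).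

Definition lin_indep (I : eqType) (B : set I) (v : I -> V) : Prop :=
  forall (s : seq I) (c : I -> R), uniq s -> (forall i, i \in s -> B i) ->
    \sum_(i <- s) c i *: v i = 0 -> forall i, i \in s -> c i = 0.

(* [S] is the internal direct sum of the free lines [R v_i], [i] in [B]. *)
Definition basis_on (I : eqType) (B : set I) (v : I -> V) (S : set V) : Prop :=
  lin_indep B v /\ S = span (v @` B).

Definition has_dim (S : set V) (d : nat) : Prop :=
  exists b : 'I_d -> V, basis_on setT b S.

(* Junk value 0 when [S] is not a finite-dimensional subspace. *)
Definition dim (S : set V) : nat := xget 0%N (has_dim S).

End Dimension.

Definition restr (S R : pzRingType) (phi : {rmorphism S -> R})
  (M : lmodType R) : Type := M.

Section Restr.
Variables (S R : pzRingType) (phi : {rmorphism S -> R}) (M : lmodType R).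

HB.instance Definition _ := GRing.Zmodule.on (restr phi M).

Definition restr_scale (s : S) (x : restr phi M) : restr phi M :=
  phi s *: (x : M).

Fact restr_scaleA a b x : restr_scale a (restr_scale b x) = restr_scale (a * b) x.
Proof. by rewrite /restr_scale scalerA rmorphM. Qed.
Fact restr_scale1 : left_id 1 restr_scale.
Proof. by move=> x; rewrite /restr_scale rmorph1 scale1r. Qed.
Fact restr_scaleDr : right_distributive restr_scale +%R.
Proof. by move=> a x y; rewrite /restr_scale scalerDr. Qed.
Fact restr_scaleDl x : {morph restr_scale^~ x : a b / a + b}.
Proof. by move=> a b; rewrite /restr_scale rmorphD scalerDl. Qed.

HB.instance Definition _ := GRing.Zmodule_isLmodule.Build S (restr phi M)
  restr_scaleA restr_scale1 restr_scaleDr restr_scaleDl.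

End Restr.

Definition endo (R : pzRingType) (M : lmodType R) : Type := {linear M -> M}.

Section Endo.
Variables (R : pzRingType) (M : lmodType R).
Local Notation E := (endo M).

HB.instance Definition _ := gen_eqMixin E.
HB.instance Definition _ := gen_choiceMixin E.

Lemma endoP (f g : E) : (forall x, f x = g x) -> f = g.
Proof.
move: f g => [f [[fA] [fS]]] [g [[gA] [gS]]] /= /funext fg.
rewrite -fg in gA gS *.
by rewrite (Prop_irrelevance fA gA) (Prop_irrelevance fS gS).
Qed.


Definition endo_zero : E := (\0 : {linear M -> M}).
Definition endo_opp (f : E) : E := (\- f : {linear M -> M}).
Definition endo_add (f g : E) : E := (f \+ g : {linear M -> M}).
Definition endo_one : E := (idfun : {linear M -> M}).
Definition endo_mul (f g : E) : E := (f \o g : {linear M -> M}).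

Fact endo_addA : associative endo_add.
Proof. by move=> f g h; apply: endoP => x /=; rewrite addrA. Qed.
Fact endo_addC : commutative endo_add.
Proof. by move=> f g; apply: endoP => x /=; rewrite addrC. Qed.
Fact endo_add0 : left_id endo_zero endo_add.
Proof. by move=> f; apply: endoP => x /=; rewrite add0r. Qed.
Fact endo_addN : left_inverse endo_zero endo_opp endo_add.
Proof. by move=> f; apply: endoP => x /=; rewrite addNr. Qed.

HB.instance Definition _ :=
  GRing.isZmodule.Build E endo_addA endo_addC endo_add0 endo_addN.

Fact endo_mulA : associative endo_mul.
Proof. by move=> f g h; apply: endoP. Qed.
Fact endo_mul1 : left_id endo_one endo_mul.
Proof. by move=> f; apply: endoP. Qed.
Fact endo_mulr1 : right_id endo_one endo_mul.
Proof. by move=> f; apply: endoP. Qed.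
Fact endo_mulDl : left_distributive endo_mul endo_add.
Proof. by move=> f g h; apply: endoP. Qed.
Fact endo_mulDr : right_distributive endo_mul endo_add.
Proof. by move=> f g h; apply: endoP => x /=; rewrite raddfD. Qed.

HB.instance Definition _ := GRing.Zmodule_isPzRing.Build E
  endo_mulA endo_mul1 endo_mulr1 endo_mulDl endo_mulDr.

Lemma endo0E x : (0 : E) x = 0. Proof. by []. Qed.
Lemma endo1E x : (1 : E) x = x. Proof. by []. Qed.
Lemma endoNE (f : E) x : (- f) x = - f x. Proof. by []. Qed.
Lemma endoDE (f g : E) x : (f + g) x = f x + g x. Proof. by []. Qed.
Lemma endoBE (f g : E) x : (f - g) x = f x - g x. Proof. by []. Qed.
Lemma endoME (f g : E) x : (f * g) x = f (g x). Proof. by []. Qed.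

End Endo.

Section DiffOps.
Variables (K : fieldType) (A : comAlgType K).

Section Mulop.
Variable a : A.
Definition mulop_fun (b : A) : A := a * b.
Fact mulop_linear : linear mulop_fun.
Proof. by move=> c x y; rewrite /mulop_fun mulrDr scalerAr. Qed.
HB.instance Definition _ := GRing.isLinear.Build K A A *:%R mulop_fun mulop_linear.
End Mulop.

Definition mulop (a : A) : endo A := (mulop_fun a : {linear A -> A}).

Lemma mulopE a b : mulop a b = a * b. Proof. by []. Qed.

Definition comm_op (a : A) (u : endo A) : endo A := mulop a * u - u * mulop a.

(* Grothendieck's definition of the operators of order at most [k]. *)
Fixpoint diffop_of_order (k : nat) (u : endo A) : Prop :=
  match k with
  | 0 => forall a, comm_op a u = 0
  | k'.+1 => forall a, diffop_of_order k' (comm_op a u)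
  end.

Definition diffop_pred : {pred endo A} :=
  [pred u | `[< exists k, diffop_of_order k u >]].

Lemma diffop_predP u :
  reflect (exists k, diffop_of_order k u) (u \in diffop_pred).
Proof. exact: asboolP. Qed.

Fact comm_opB a u v : comm_op a (u - v) = comm_op a u - comm_op a v.
Proof. by rewrite /comm_op mulrBr mulrBl !opprD !opprK addrACA. Qed.

Fact comm_opM a u v : comm_op a (u * v) = comm_op a u * v + u * comm_op a v.
Proof. by rewrite /comm_op mulrBr mulrBl !mulrA addrA subrK. Qed.

Fact comm_op_mulop a b : comm_op a (mulop b) = 0.
Proof.
by apply: endoP => x; rewrite endoBE !endoME !mulopE mulrCA subrr.
Qed.

Fact diffop_of_order0 k : diffop_of_order k 0.
Proof.
have c0 a : comm_op a 0 = 0 by rewrite /comm_op mulr0 mul0r subrr.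
by elim: k => [|k IHk] a; rewrite c0.
Qed.

Fact diffop_of_orderS k u : diffop_of_order k u -> diffop_of_order k.+1 u.
Proof.
elim: k u => [|k IHk] u Hu a; last exact: IHk.
by rewrite (Hu a); apply: (diffop_of_order0 0).
Qed.

Fact diffop_of_order_le j k u :
  (j <= k)%N -> diffop_of_order j u -> diffop_of_order k u.
Proof.
move/subnK <-; elim: (k - j)%N => // d IHd /IHd.
exact: diffop_of_orderS.
Qed.

Fact diffop_of_orderB k u v :
  diffop_of_order k u -> diffop_of_order k v -> diffop_of_order k (u - v).
Proof.
elim: k u v => [|k IHk] u v Hu Hv a; rewrite comm_opB.
  by rewrite (Hu a) (Hv a) subrr.
exact: IHk.
Qed.

Fact diffop_of_orderD k u v :
  diffop_of_order k u -> diffop_of_order k v -> diffop_of_order k (u + v).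
Proof.
move=> Hu Hv; rewrite -[v]opprK -[- v]add0r.
by apply: diffop_of_orderB => //; apply: diffop_of_orderB => //; exact (diffop_of_order0 k).
Qed.

Fact diffop_of_orderM j k u v :
  diffop_of_order j u -> diffop_of_order k v -> diffop_of_order (j + k) (u * v).
Proof.
have [N] := ubnP (j + k)%N; elim: N j k u v => // N IHN.
move=> [|j] [|k] u v lt_jk Hu Hv a; rewrite ?comm_opM.
- by rewrite (Hu a) (Hv a) mul0r mulr0 addr0.
- by rewrite (Hu a) mul0r add0r; apply: (IHN 0%N k).
- by rewrite (Hv a) mulr0 addr0; apply: (IHN j 0%N) => //; rewrite !addn0 in lt_jk *.
- apply: diffop_of_orderD; first by apply: IHN.
  have lt_jk' : (j.+1 + k < N)%N by rewrite addSnnS.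
  apply: (diffop_of_order_le _ (IHN j.+1 k _ _ lt_jk' Hu (Hv a))).
  by rewrite addSnnS.
Qed.

Fact diffop_mulop a : diffop_of_order 0 (mulop a).
Proof. by move=> b; apply: comm_op_mulop. Qed.

Fact diffop_subring_closed : subring_closed diffop_pred.
Proof.
split=> [|u v /diffop_predP[j Hu] /diffop_predP[k Hv]|
         u v /diffop_predP[j Hu] /diffop_predP[k Hv]]; apply/diffop_predP.
- exists 0%N => a; rewrite /comm_op mulr1 mul1r subrr //.
- exists (maxn j k); apply: diffop_of_orderB.
    exact: diffop_of_order_le (leq_maxl _ _) Hu.
  exact: diffop_of_order_le (leq_maxr _ _) Hv.
- by exists (j + k)%N; apply: diffop_of_orderM.
Qed.

HB.instance Definition _ :=
  GRing.isSubringClosed.Build (endo A) diffop_pred diffop_subring_closed.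

Record diffops : Type := DiffOp {
  diffop_val :> endo A;
  _ : diffop_val \in diffop_pred
}.

HB.instance Definition _ := [isSub for diffop_val].
HB.instance Definition _ := [Choice of diffops by <:].
HB.instance Definition _ :=
  GRing.SubChoice_isSubPzRing.Build _ _ diffops diffop_subring_closed.

Fact mul_diffop_subproof a : mulop a \in diffop_pred.
Proof. by apply/diffop_predP; exists 0%N; apply: diffop_mulop. Qed.

Definition mul_diffop (a : A) : diffops := DiffOp (mul_diffop_subproof a).

Fact mul_diffop_zmod_morphism : zmod_morphism mul_diffop.
Proof.
move=> a b; apply/val_inj; rewrite [RHS]rmorphB /=; apply/endoP => x.
by rewrite endoBE !mulopE mulrBl.
Qed.
Fact mul_diffop_monoid_morphism : monoid_morphism mul_diffop.
Proof.
split=> [|a b]; apply/val_inj.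
  by rewrite [RHS]rmorph1 /=; apply/endoP => x; rewrite mulopE mul1r.
by rewrite [RHS]rmorphM /=; apply/endoP => x; rewrite endoME !mulopE mulrA.
Qed.

HB.instance Definition _ :=
  GRing.isZmodMorphism.Build A diffops mul_diffop mul_diffop_zmod_morphism.
HB.instance Definition _ :=
  GRing.isMonoidMorphism.Build A diffops mul_diffop mul_diffop_monoid_morphism.

End DiffOps.

(* [A (x)_S B] for a right S-module [A], whose action is given by [ract], and *)
(* a left S-module [B].                                                       *)
Section Tensor.
Variables (A : zmodType) (S : pzRingType) (ract : A -> S -> A).
Variable (B : lmodType S).

Definition tensor_free : Type := {freeg (A * B)%type}.
HB.instance Definition _ := GRing.Lmodule.on tensor_free.

Definition tensor_gen (a : A) (b : B) : tensor_free := << (a, b) >>.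

Definition tensor_rel : set tensor_free :=
  [set z | [\/ exists a a' b,
                 z = tensor_gen (a + a') b - (tensor_gen a b + tensor_gen a' b),
               exists a b b',
                 z = tensor_gen a (b + b') - (tensor_gen a b + tensor_gen a b')
             | exists a s b, z = tensor_gen (ract a s) b - tensor_gen a (s *: b)]].

Definition tensor : Type := {ideal_quot (span_pred tensor_rel)}.
HB.instance Definition _ := GRing.Zmodule.on tensor.

Definition tens (a : A) (b : B) : tensor :=
  \pi_{ideal_quot (span_pred tensor_rel)} (tensor_gen a b).

End Tensor.

(* Extension of scalars [R (x)_S B] along [phi]: R is a right S-module through *)
(* [phi], and the left R-module structure is [r (a (x) b) = (r a) (x) b].      *)
Definition extscal (S R : pzRingType) (phi : {rmorphism S -> R})
  (B : lmodType S) : Type := tensor (fun (a : R) s => a * phi s) B.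

Section ExtScal.
Variables (S R : pzRingType) (phi : {rmorphism S -> R}) (B : lmodType S).
Local Notation ract := (fun (a : R) (s : S) => a * phi s).
Local Notation F := (tensor_free R B).
Local Notation N := (span_pred (tensor_rel ract (B := B))).
Local Notation Q := {ideal_quot N}.

HB.instance Definition _ := GRing.Zmodule.on (extscal phi B).

Definition extscal_lact (r : R) : F -> F :=
  fglift (fun ab => tensor_gen (r * ab.1) ab.2).

Fact extscal_lact_zmod_morphism r : zmod_morphism (extscal_lact r).
Proof. exact: lift_is_additive. Qed.
HB.instance Definition _ r := GRing.isZmodMorphism.Build F F (extscal_lact r)
  (extscal_lact_zmod_morphism r).

Fact extscal_lact_gen r a b :
  extscal_lact r (tensor_gen a b) = tensor_gen (r * a) b.
Proof. by rewrite /extscal_lact /tensor_gen liftU scale1r. Qed.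

Fact extscal_lactN r z : z \in N -> extscal_lact r z \in N.
Proof.
case/span_predP => m [c [x [Xx ->]]]; rewrite raddf_sum; apply: rpred_sum => i _.
rewrite -[c i]intz scaler_int raddfMz -scaler_int rpredZ //.
apply/span_predP; exists 1%N, (fun=> 1), (fun=> extscal_lact r (x i)).
split; last by rewrite big_ord1 scale1r.
move=> _; case: (Xx i) => [[a [a' [b ->]]]|[a [b [b' ->]]]|[a [s [b ->]]]].
- by apply: Or31; exists (r * a), (r * a'), b;
    rewrite raddfB raddfD /= !extscal_lact_gen mulrDr.
- by apply: Or32; exists (r * a), b, b'; rewrite raddfB raddfD /= !extscal_lact_gen.
- by apply: Or33; exists (r * a), s, b; rewrite raddfB /= !extscal_lact_gen mulrA.
Qed.

Definition extscal_scale (r : R) (x : extscal phi B) : extscal phi B :=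
  \pi_Q (extscal_lact r (repr (x : Q))).

Fact extscal_pi_eq (x y : F) : x - y \in N -> \pi_Q x = \pi_Q y.
Proof. by move=> xyN; apply/eqP; rewrite -Quotient.idealrBE. Qed.

Fact extscal_scale_pi r z : extscal_scale r (\pi_Q z) = \pi_Q (extscal_lact r z).
Proof.
apply: extscal_pi_eq; rewrite -raddfB /=; apply: extscal_lactN.
by rewrite Quotient.idealrBE reprK.
Qed.

Lemma extscal_scale_tens r a b :
  extscal_scale r (tens ract a b) = tens ract (r * a) b.
Proof. by rewrite /tens extscal_scale_pi extscal_lact_gen. Qed.

Lemma tens_ind (P : extscal phi B -> Prop) :
  P 0 -> (forall x y, P x -> P y -> P (x - y)) ->
  (forall a b, P (tens ract a b)) -> forall x, P x.
Proof.
move=> P0 PB Pt x; rewrite -[x](reprK (x : Q)).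
have PD u v : P u -> P v -> P (u + v).
  move=> Pu Pv; rewrite -[v]opprK -[- v]sub0r; apply/PB => //; exact: PB.
pose z : {freeg (R * B)%type} := repr (x : Q).
rewrite -[repr _](freeg_sumE z) raddf_sum; elim/big_rec: _ => // ab u _ Pu.
apply: (PD) => //; rewrite -[coeff ab z]intz -freegU_mulz raddfMz.
case: ab => a b; case: (coeff _ _) => k.
  rewrite -pmulrn; elim: k => [|k IHk]; first by rewrite mulr0n.
  by rewrite mulrS; apply: (PD) => //; exact: Pt.
rewrite NegzE mulrNz -pmulrn -sub0r; apply: (PB) => //.
elim: k => [|k IHk]; first by rewrite mulr1n; exact: Pt.
by rewrite mulrS; apply: (PD) => //; exact: Pt.
Qed.

Fact extscal_scaleB r x y :
  extscal_scale r (x - y) = extscal_scale r x - extscal_scale r y.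
Proof.
rewrite -[x](reprK (x : Q)) -[y](reprK (y : Q)) -[X in extscal_scale r X]raddfB.
by rewrite !extscal_scale_pi !raddfB.
Qed.

Fact extscal_scale0 r : extscal_scale r 0 = 0.
Proof. by rewrite -{1}(subrr 0) extscal_scaleB subrr. Qed.

Fact extscal_scaleA a b x :
  extscal_scale a (extscal_scale b x) = extscal_scale (a * b) x.
Proof.
elim/tens_ind: x => [|x y IHx IHy|c d]; first by rewrite !extscal_scale0.
  by rewrite !extscal_scaleB IHx IHy.
by rewrite !extscal_scale_tens mulrA.
Qed.

Fact extscal_scale1 : left_id 1 extscal_scale.
Proof.
elim/tens_ind => [|x y IHx IHy|c d]; first exact: extscal_scale0.
  by rewrite extscal_scaleB IHx IHy.
by rewrite extscal_scale_tens mul1r.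
Qed.

Fact extscal_scaleDr : right_distributive extscal_scale +%R.
Proof.
move=> r x y; rewrite -{1}[y]opprK extscal_scaleB; congr (_ + _).
by rewrite -[- y]sub0r extscal_scaleB extscal_scale0 sub0r opprK.
Qed.

Fact tens_addl a a' (b : B) : tens ract (a + a') b = tens ract a b + tens ract a' b.
Proof.
rewrite /tens -[RHS]raddfD; apply: extscal_pi_eq.
apply/span_predP; exists 1%N, (fun=> 1), (fun=> tensor_gen (a + a') b - (tensor_gen a b + tensor_gen a' b)).
split; last by rewrite big_ord1 scale1r.
by move=> _; apply: Or31; exists a, a', b.
Qed.

Fact extscal_scaleDl x : {morph extscal_scale^~ x : a b / a + b}.
Proof.
move=> a b; elim/tens_ind: x => [|x y IHx IHy|c d].
- by rewrite !extscal_scale0 addr0.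
- by rewrite !extscal_scaleB IHx IHy opprD addrACA.
- by rewrite !extscal_scale_tens mulrDl tens_addl.
Qed.

HB.instance Definition _ := GRing.Zmodule_isLmodule.Build R (extscal phi B)
  extscal_scaleA extscal_scale1 extscal_scaleDr extscal_scaleDl.

End ExtScal.

Section Modules.
Variable R : pzRingType.

Definition isomorphic (M N : lmodType R) : Prop :=
  exists f : {linear M -> N}, bijective f.

Definition simple_module (M : lmodType R) : Prop :=
  (exists x : M, x != 0) /\
  forall N : submodClosed M,
    (forall x, x \in N -> x = 0) \/ (forall x, x \in N).

(* R^s --f--> R^r --g--> M --> 0 is exact. *)
Definition finitely_presented (M : lmodType R) : Prop :=
  exists (r s : nat) (f : {linear 'rV[R]_s -> 'rV[R]_r})
         (g : {linear 'rV[R]_r -> M}),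
    (forall x, exists v, g v = x) /\
    (forall v, g v = 0 <-> exists w, v = f w).

(* [lmodType R] lives in too large a universe for [set (lmodType R)], hence  *)
(* the plain predicates.                                                      *)
Definition isoclass (M : lmodType R) : lmodType R -> Prop := isomorphic M.

Definition simple_fp_class (C : lmodType R -> Prop) : Prop :=
  exists M, [/\ simple_module M, finitely_presented M & C = isoclass M].

End Modules.

Definition bijection_between (X Y : Type) (A : X -> Prop) (B : Y -> Prop)
  (f : X -> Y) : Prop :=
  [/\ forall x, A x -> B (f x),
      forall x x', A x -> A x' -> f x = f x' -> x = x'
    & forall y, B y -> exists2 x, A x & f x = y].

Section Ideals.
Variable R : comNzRingType.

Lemma idealr_eqP (I J : idealr R) : (forall x, (x \in I) = (x \in J)) -> I = J.
Proof.
move: I J => [I [[IA] [IB] [IC]]] [J [[JA] [JB] [JC]]] /= IJ.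
have {}IJ : I = J by apply: funext => x; exact: IJ.
rewrite -IJ in JA JB JC *.
by rewrite (Prop_irrelevance IA JA) (Prop_irrelevance IB JB)
           (Prop_irrelevance IC JC).
Qed.

(* [idealr R] consists of the proper ideals only. *)
Definition maximal_idealr : set (idealr R) :=
  [set I : idealr R | forall J : idealr R, {subset I <= J} -> J = I].

Definition ass (M : lmodType R) : set (idealr R) :=
  [set I : idealr R | prime_idealr_closed I /\
           exists x : M, forall a, a \in I <-> a *: x = 0].

Definition residue (I : idealr R) : Type :=
  restr (\pi_{ideal_quot I} : {rmorphism R -> {ideal_quot I}}) {ideal_quot I}^o.

HB.instance Definition _ (I : idealr R) := GRing.Lmodule.on (residue I).

Definition residue_class (I : idealr R) (a : R) : residue I :=
  \pi_{ideal_quot I} a.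

End Ideals.

Section PolyDiffOps.
Variables (K : fieldType) (n : nat).
Local Notation P := {mpoly K[n]}.
Local Notation D := (diffops {mpoly K[n]}).

(* The divided power d_i^j / j!, defined on monomials; when [m i < j] the      *)
(* binomial vanishes, so the truncated subtraction is harmless.               *)
Definition dpow_fun (i : 'I_n) (j : nat) (p : P) : P :=
  \sum_(m <- msupp p) (p@_m * 'C(m i, j)%:R) *: 'X_[m - U_(i) *+ j].

Lemma mcoeff_dpow i j p m :
  (dpow_fun i j p)@_m = p@_(m + U_(i) *+ j) * 'C(m i + j, j)%:R.
Proof.
rewrite raddf_sum /=.
have E k : ((p@_k * 'C(k i, j)%:R) *: 'X_[k - U_(i) *+ j])@_m =
  if k == (m + U_(i) *+ j)%MM then p@_k * 'C(m i + j, j)%:R else 0 :> K.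
  rewrite mcoeffZ mcoeffX; case: (ltnP (k i) j) => [lt_kj|le_jk].
    rewrite bin_small // mulr0 mul0r; case: eqP => // kE.
    by move: lt_kj; rewrite kE mnmDE mulmnE mnm1E eqxx mul1n ltnNge leq_addl.
  have le_Uk : (U_(i) *+ j <= k)%MM.
    by apply/mnm_lepP => l; rewrite mulmnE mnm1E; case: eqP => [<-|_];
      rewrite ?mul1n ?mul0n.
  case: (k =P _) => [->|neq].
    by rewrite addmK eqxx mulr1 mnmDE mulmnE mnm1E eqxx mul1n.
  case: eqP => [km|_]; last by rewrite mulr0.
  by case: neq; rewrite -km submK.
rewrite (eq_bigr _ (fun k _ => E k)).
have [inS|notinS] := boolP (m + U_(i) *+ j \in msupp p)%MM.
  rewrite (bigD1_seq _ inS (msupp_uniq p)) eqxx /= big1 ?addr0 // => k.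
  by move/negPf->.
rewrite big_seq big1 => [|k kS].
  by rewrite (memN_msupp_eq0 notinS) mul0r.
by case: eqP => // kE; rewrite -kE kS in notinS.
Qed.

Fact dpow_linear i j : linear (dpow_fun i j).
Proof.
move=> c p q; apply/mpolyP => m.
by rewrite mcoeffD mcoeffZ !mcoeff_dpow mcoeffD mcoeffZ mulrDl mulrA.
Qed.
HB.instance Definition _ i j :=
  GRing.isLinear.Build K P P *:%R (dpow_fun i j) (dpow_linear i j).

Lemma dpow_funX i j m :
  dpow_fun i j 'X_[m] = 'C(m i, j)%:R *: 'X_[m - U_(i) *+ j].
Proof. by rewrite /dpow_fun msuppX big_seq1 mcoeffX eqxx mul1r. Qed.

Lemma dpow_funM i j p q :
  dpow_fun i j (p * q) =
  \sum_(k < j.+1) dpow_fun i k p * dpow_fun i (j - k) q.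
Proof.
have X2 m1 m2 : dpow_fun i j ('X_[m1] * 'X_[m2]) =
    \sum_(k < j.+1) dpow_fun i k 'X_[m1] * dpow_fun i (j - k) 'X_[m2].
  rewrite -mpolyXD dpow_funX mnmDE -binomial.Vandermonde natr_sum scaler_suml.
  apply: eq_bigr => k _; rewrite !dpow_funX natrM.
  rewrite -scalerAl -scalerAr scalerA -mpolyXD.
  have [lt1|le1] := ltnP (m1 i) k; first by rewrite bin_small // !mul0r !scale0r.
  have [lt2|le2] := ltnP (m2 i) (j - k).
    by rewrite [in 'C(m2 i, _)]bin_small // !mulr0 !scale0r.
  congr (_ *: 'X_[_]); apply/mnmP => l.
  rewrite !(mnmDE, mnmBE, mulmnE, mnm1E); case: eqP => [<-|_]; last first.
    by rewrite !mul0n !subn0.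
  have kj : (k <= j)%N by rewrite -ltnS.
  by rewrite !mul1n -{1}(subnKC kj) subnDA -addnBAC // addnBA.
have X1 m1 : dpow_fun i j ('X_[m1] * q) =
    \sum_(k < j.+1) dpow_fun i k 'X_[m1] * dpow_fun i (j - k) q.
  rewrite {1}[q]mpolyE mulr_sumr linear_sum /=.
  under eq_bigr => m _ do rewrite -scalerAr linearZ /= X2 scaler_sumr.
  rewrite exchange_big; apply: eq_bigr => k _ /=.
  rewrite [in RHS](mpolyE q) linear_sum /= mulr_sumr; apply: eq_bigr => m _.
  by rewrite linearZ /= -scalerAr.
rewrite {1}[p]mpolyE mulr_suml linear_sum /=.
under eq_bigr => m _ do rewrite -scalerAl linearZ /= X1 scaler_sumr.
rewrite exchange_big; apply: eq_bigr => k _ /=.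
rewrite [in RHS](mpolyE p) linear_sum /= mulr_suml; apply: eq_bigr => m _.
by rewrite linearZ /= -scalerAl.
Qed.

Definition dpow_op (i : 'I_n) (j : nat) : endo P :=
  (dpow_fun i j : {linear P -> P}).

Lemma dpow_opE i j p : dpow_op i j p = dpow_fun i j p. Proof. by []. Qed.

Fact dpow_fun0 i p : dpow_fun i 0 p = p.
Proof. by apply/mpolyP => m; rewrite mcoeff_dpow mulm0n addm0 bin0 mulr1. Qed.

Fact dpow_op_order i j : diffop_of_order j (dpow_op i j).
Proof.
have [N] := ubnP j; elim: N j => // N IHN [|j] lt_jN.
  move=> a; apply: endoP => p.
  by rewrite endoBE !endoME !mulopE !dpow_opE !dpow_fun0 subrr.
move=> a.
have -> : comm_op a (dpow_op i j.+1) =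
    0 - \sum_(k < j.+1) mulop (dpow_op i k.+1 a) * dpow_op i (j - k).
  apply: endoP => p; rewrite !endoBE !endoME !mulopE !dpow_opE dpow_funM.
  rewrite big_ord_recl dpow_fun0 subn0 opprD addrA subrr; congr (_ - _).
  by elim/big_rec2: _ => // k x y _ ->; rewrite endoDE endoME mulopE.
apply: diffop_of_orderB; first exact (diffop_of_order0 _ j).
elim/big_rec: _ => [|k u _ Hu]; first exact (diffop_of_order0 _ j).
apply: diffop_of_orderD => //.
apply: (@diffop_of_order_le _ _ (0 + (j - k))); first exact: leq_subr.
apply: diffop_of_orderM; first exact: diffop_mulop.
apply: IHN; apply: leq_ltn_trans (leq_subr _ _) _; exact: lt_jN.
Qed.

Fact dpow_subproof i j : dpow_op i j \in @diffop_pred K P.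
Proof. by apply/diffop_predP; exists j; apply: dpow_op_order. Qed.

Definition dpow (i : 'I_n) (j : nat) : D := DiffOp (dpow_subproof i j).

Definition dpows (b : 'X_{1..n}) : D := \prod_(i < n) dpow i (b i).

Definition xmon (a : 'X_{1..n}) : D := mul_diffop ('X_[a] : P).

Definition constP : {rmorphism K -> P} := @mpolyC n K.
Definition constD : {rmorphism K -> D} := @mul_diffop K P \o constP.

Definition assP (M : lmodType D) : set (idealr P) :=
  ass (restr (@mul_diffop K P) M).

Definition Kspace (M : lmodType D) : lmodType K := restr constD M.

Definition canon_filtration (i : nat) : set D :=
  span (V := Kspace D^o)
    [set d | exists a b : 'X_{1..n}, (mdeg a + mdeg b <= i)%N /\ d = xmon a * dpows b].

Definition Lambda_pred : {pred Kspace D^o} :=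
  span_pred (V := Kspace D^o) (range dpows).

Record Lambda : Type := LambdaOp {
  Lambda_val : Kspace D^o;
  _ : Lambda_val \in Lambda_pred
}.

HB.instance Definition _ := [isSub for Lambda_val].
HB.instance Definition _ := [Choice of Lambda by <:].
HB.instance Definition _ := GRing.SubmodClosed.on Lambda_pred.
HB.instance Definition _ := [SubChoice_isSubLmodule of Lambda by <:].

Definition Lambda_diffop (l : Lambda) : D := Lambda_val l.

Definition point_ideal_pred (x : 'I_n -> K) : {pred P} :=
  [pred f | `[< exists g : 'I_n -> P, f = \sum_(i < n) g i * ('X_i - (x i)%:MP) >]].

Lemma point_ideal_predP x f :
  reflect (exists g : 'I_n -> P, f = \sum_(i < n) g i * ('X_i - (x i)%:MP))
    (f \in point_ideal_pred x).
Proof. exact: asboolP. Qed.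

Fact point_ideal_closed x : idealr_closed (point_ideal_pred x).
Proof.
split=> [||a u v /point_ideal_predP[g ->] /point_ideal_predP[h ->]].
- by apply/point_ideal_predP; exists (fun=> 0); rewrite big1 // => i _; rewrite mul0r.
- apply/point_ideal_predP => -[g /(congr1 (fun f : P => f.@[x]))].
  rewrite meval1 raddf_sum big1; first by move/eqP; rewrite oner_eq0.
  by move=> i _; rewrite /= mevalM mevalB mevalXU mevalC subrr mulr0.
- apply/point_ideal_predP; exists (fun i => a * g i + h i).
  rewrite mulr_sumr -big_split; apply: eq_bigr => i _.
  by rewrite mulrDl mulrA.
Qed.

HB.instance Definition _ x :=
  isIdealr.Build P (point_ideal_pred x) (point_ideal_closed x).

Definition point_ideal (x : 'I_n -> K) : idealr P := point_ideal_pred x.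

Definition Umod (m : idealr P) : lmodType D :=
  extscal (@mul_diffop K P) (residue m).

Definition Utens (m : idealr P) (d : D) (q : residue m) : Umod m :=
  tens (fun (d : D) f => d * mul_diffop f) d q.

Definition Ubar1 (m : idealr P) : Umod m := Utens 1 (residue_class m 1).

(* Lambda (x)_K P_n/m, where the right action of K on Lambda is its scaling. *)
Definition LambdaTensor (m : idealr P) : zmodType :=
  tensor (fun (l : Lambda) (c : K) => c *: l) (restr constP (residue m)).

Definition LambdaTens (m : idealr P) (l : Lambda) (q : residue m) : LambdaTensor m :=
  tens (fun (l : Lambda) (c : K) => c *: l) l (q : restr constP (residue m)).

Definition Ufilt (m : idealr P) (i : nat) : set (Umod m) :=
  [set d *: Ubar1 m | d in canon_filtration i].

Definition filt (M : lmodType D) (M0 : set M) (i : nat) : set M :=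
  span (V := Kspace M)
    [set v | exists d w, [/\ canon_filtration i d, M0 w & v = d *: w]].

Definition Kdim (M : lmodType D) (S : set M) : nat := dim (V := Kspace M) S.

Definition fin_dim (M : lmodType D) (S : set M) : Prop :=
  exists d, has_dim (V := Kspace M) S d.

Definition fd_generating (M : lmodType D) (M0 : set M) : Prop :=
  fin_dim M0 /\ span (V := M) M0 = setT.

(* dim_K (F_i M_0) = (e / n!) i^n + o(i^n) *)
Definition growth (M : lmodType D) (M0 : set M) (e : rat) : Prop :=
  forall eps : rat, 0 < eps -> exists N : nat, forall i : nat, (N <= i)%N ->
    `|(Kdim (filt M0 i))%:R - e / n`!%:R * i%:R ^+ n| <= eps * i%:R ^+ n.

(* [e] is the multiplicity of [M]: the common value for all [M_0]. *)
Definition is_multiplicity (M : lmodType D) (e : rat) : Prop :=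
  (exists M0 : set M, fd_generating M0) /\
  forall M0 : set M, fd_generating M0 -> growth M0 e.

End PolyDiffOps.

Arguments Ufilt {K n} m i.

(* Formal power series are coefficient sequences; [series_mul] is the Cauchy   *)
(* product.                                                                   *)
Definition series_mul (f g : nat -> int) : nat -> int :=
  fun k => \sum_(i < k.+1) f i * g (k - i)%N.

Definition series_of_poly (q : {poly int}) : nat -> int := fun k => q`_k.

(* [f = 1 / q] in Z[[w]] *)
Definition series_eq_inv (f : nat -> int) (q : {poly int}) : Prop :=
  forall k, series_mul f (series_of_poly q) k = (k == 0%N)%:R.

(* Main.v *)
(** Write D for the ring of differential operators, U(a) for the module of the
    point a and delta for its generator 1 (x) 1.

    Divided powers satisfy (x_i - a_i) d^[b] delta = - d^[b - e_i] delta, so a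
    monomial in the x_i - a_i isolates the coefficient of a term of maximal
    degree in a combination of the d^[b] delta. Hence these vectors are
    independent, U(a) is simple, its vectors killed by all the x_i - a_i are the
    multiples of delta, and its only associated prime is the ideal of a.

    A differential operator of order less than q = p^e is linear over the q-th
    powers. The operator T = d^[(q-1, ..., q-1)] takes its values in the
    polynomials in the x_i^q, and f is the sum over b < q of
    T(x^(q-1-b) f) x^b. Thus u T = u(1) T for every such operator u, and D delta
    is spanned by the d^[b] delta.

    For a finitely presented M = D^r / D^s B, a suitable q turns B into a matrix
    E over the polynomials in the x_i^q. If E is injective at every point, its
    maximal minors generate the unit ideal (Nullstellensatz), so that B is left
    invertible and M = 0. Otherwise, a vector killed by E at a point yields,
    after multiplication by T delta, a nonzero solution of B v = 0 in some U(a),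
    that is, a nonzero map from M to U(a). *)
Require Import Defs.
From HB Require Import structures.
From mathcomp Require Import all_boot all_order all_algebra.
From mathcomp Require Import boolp classical_sets functions.
From mathcomp Require Import mpoly freeg.
From mathcomp Require Import zify.

Set Implicit Arguments.
Unset Strict Implicit.
Unset Printing Implicit Defensive.

Import Order.TTheory GRing.Theory Num.Theory.

Local Open Scope classical_set_scope.
Local Open Scope ring_scope.

(** * The Nullstellensatz *)

(** Operators linear over the polynomials in the x_i^q form a matrix algebra of size q^n over that
    commutative ring, and every differential operator lies in one of them. Finite presentation
    matters because finitely many operators fit into a single one, where linear algebra over D turns
    into the matrix [E]; an infinite family may admit no common q. A point where [E] degenerates is
    the coordinatewise q-th power of the point a, so algebraic closure serves twice: for the
    Nullstellensatz and for q-th roots. The modules are quotients of free abelian groups, so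
    nonvanishing is the delicate point. It is always reduced to delta being nonzero, that is, to 1
    not lying in the left ideal generated by the x_i - a_i. Such a relation is refuted by applying
    it to the product of the (x_i - a_i)^(q-1), then T, then evaluation at a. The Nullstellensatz
    goes by induction on the variables. Its statement carries an element outside the prime ideal,
    because eliminating a variable requires certain leading coefficients not to vanish at the chosen
    point. *)

Record prime_ideal (A : comNzRingType) (Q : A -> Prop) : Prop := PrimeIdeal {
  prime_ideal0 : Q 0;
  prime_idealD : forall u v, Q u -> Q v -> Q (u + v);
  prime_idealMl : forall a u, Q u -> Q (a * u);
  prime_ideal1 : ~ Q 1;
  prime_idealP : forall u v, Q (u * v) -> Q u \/ Q v }.

Section PrimeIdeal.
Variables (A : comNzRingType) (Q : A -> Prop) (Qp : prime_ideal Q).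

Lemma prime_idealN u : Q u -> Q (- u).
Proof. by move=> Qu; rewrite -mulN1r; apply: prime_idealMl. Qed.

Lemma prime_idealB u v : Q u -> Q v -> Q (u - v).
Proof. by move=> Qu Qv; apply: prime_idealD => //; apply: prime_idealN. Qed.

Lemma prime_ideal_sum (I : Type) (r : seq I) (F : I -> A) :
  (forall i, Q (F i)) -> Q (\sum_(i <- r) F i).
Proof.
by move=> QF; elim/big_rec: _ => [|i u _ Qu]; [exact: prime_ideal0 | exact: prime_idealD].
Qed.

Lemma prime_idealX u k : Q (u ^+ k) -> Q u.
Proof.
elim: k => [|k IHk]; first by rewrite expr0 => /(prime_ideal1 Qp).
by rewrite exprS => /(prime_idealP Qp)[].
Qed.

End PrimeIdeal.

Lemma ex_min_size (A : nzSemiRingType) (G : {poly A} -> Prop) :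
  (exists g, G g) -> exists2 g, G g & forall h, G h -> (size g <= size h)%N.
Proof.
case=> g0 Gg0.
have exk : exists k, `[< exists2 g, G g & size g = k >].
  by exists (size g0); apply/asboolP; exists g0.
case: (ex_minnP exk) => k /asboolP[g Gg <-] min; exists g => // h Gh.
by apply: min; apply/asboolP; exists h.
Qed.

Lemma size_drop_lead (A : nzRingType) (h : {poly A}) : h != 0 ->
  (size (h - lead_coef h *: 'X^((size h).-1))%R < size h)%N.
Proof.
move=> h0; have sh : (0 < size h)%N by rewrite size_poly_gt0.
rewrite -{2}(prednK sh) ltnS; apply/leq_sizeP => j.
rewrite leq_eqVlt => /predU1P[<-|lt_j]; rewrite coefB coefZ coefXn.
  by rewrite eqxx mulr1 subrr.
rewrite gtn_eqF // mulr0 subr0 nth_default //.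
by rewrite -(prednK sh).
Qed.

Section Points.
Variable K : closedFieldType.

(* The Nullstellensatz for a K-algebra [A], in the form that makes the step   *)
(* from [A] to [A[t]] possible: K-points separate prime ideals from elements. *)
Definition has_points (A : idomainType) (iota : K -> A) : Prop :=
  forall Q : A -> Prop, prime_ideal Q -> forall f, ~ Q f ->
  exists phi : {rmorphism A -> K},
    [/\ forall c, phi (iota c) = c, forall h, Q h -> phi h = 0 & phi f != 0].

(** Let [Q0] be the contraction of [Q] to [A]. Either [Q] is extended from [Q0], or over the
    fraction field of [A/Q0] it becomes principal and [f] a unit modulo it. Pseudo-division keeps
    the second case inside [A[t]], at the price of two elements [b] and [c] of [A] that the point
    must not kill. *)
Lemma has_points_poly (A : idomainType) (iota : K -> A) :
  has_points iota -> has_points (fun c => (iota c)%:P).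
Proof.
move=> ptsA Q Qp f Qf; pose Q0 a := Q a%:P.
have Q0p : prime_ideal Q0.
  split; rewrite /Q0.
  - exact: (prime_ideal0 Qp).
  - by move=> u v; rewrite polyCD; apply: (prime_idealD Qp).
  - by move=> a u; rewrite polyCM; apply: (prime_idealMl Qp).
  - exact: (prime_ideal1 Qp).
  - by move=> u v; rewrite polyCM; apply: (prime_idealP Qp).
have QZ a h : Q h -> Q (a *: h).
  by rewrite -mul_polyC; apply: (prime_idealMl Qp).
have Q0Z a h : Q0 a -> Q (a *: h).
  by rewrite -mul_polyC mulrC; apply: (prime_idealMl Qp).
have Qcoef (h : {poly A}) : (forall i, Q0 h`_i) -> Q h.
  move=> Qh; rewrite -[h]coefK poly_def; apply: (prime_ideal_sum Qp) => i.
  exact: Q0Z.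
have lift (phi : {rmorphism A -> K}) (t : K) : exists psi : {rmorphism {poly A} -> K}, forall h : {poly A}, psi h = (map_poly phi h).[t].
  by exists (horner_eval t \o map_poly phi).
(* If all coefficients of all members of [Q] lie in [Q0], it suffices to take a point of [A] that
   keeps one coefficient of [f] alive, and [t] outside the roots of the specialised [f]. *)
have [[g0 [Qg0 [i0 Qg0i]]]|allQ0] := pselect (exists g : {poly A}, Q g /\ exists i, ~ Q0 g`_i);
    last first.
  have Qi (h : {poly A}) i : Q h -> Q0 h`_i.
    by move=> Qh; apply: contrapT => Qhi; apply: allQ0; exists h; split=> //; exists i.
  have [i Qfi] : exists i, ~ Q0 f`_i.
    by apply: contrapT => Qfi; apply: Qf; apply: Qcoef => i;
       apply: contrapT => ?; apply: Qfi; exists i.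
  have [phi [phi_i phiQ phif]] := ptsA Q0 Q0p _ Qfi.
  have f0 : map_poly phi f != 0.
    by apply: contra_neq phif => f0; rewrite -coef_map f0 coef0.
  have /closed_nonrootP[t ft] := f0.
  have [psi psiE] := lift phi t; exists psi.
  split=> [c|h Qh|]; rewrite psiE; [by rewrite map_polyC /= hornerC phi_i| |by []].
  suff -> : map_poly phi h = 0 by rewrite horner0.
  by apply/polyP => j; rewrite coef_map coef0; apply: phiQ; apply: Qi.
(* Up to powers of its leading coefficient, [g] generates [Q] modulo the extension of [Q0]: by
   minimality, any smaller member of [Q] has all its coefficients in [Q0]. *)
have [g [Qg Qgi] gmin] := @ex_min_size _ (fun g : {poly A} => Q g /\ exists i, ~ Q0 g`_i)
  (ex_intro _ g0 (conj Qg0 (ex_intro _ i0 Qg0i))).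
have Qsmall (h : {poly A}) i : Q h -> (size h < size g)%N -> Q0 h`_i.
  move=> Qh lt_hg; apply: contrapT => Qhi.
  by move: lt_hg; rewrite ltnNge => /negP; apply; apply: gmin; split=> //; exists i.
have g0n : g != 0.
  by case: Qgi => i Qgi; apply/eqP => gE; apply: Qgi; rewrite gE coef0;
     apply: (prime_ideal0 Q0p).
pose c := lead_coef g.
have Qc : ~ Q0 c.
  move=> Qc; case: Qgi => i; apply.
  have := @Qsmall (g - c *: 'X^((size g).-1)) i _ (size_drop_lead g0n).
  rewrite coefB coefZ => /(_ (prime_idealB Qp Qg (Q0Z _ _ Qc))) Qd.
  rewrite -[g`_i](subrK (c * 'X^((size g).-1)`_i)); apply: (prime_idealD Q0p) => //.
  by rewrite mulrC; apply: (prime_idealMl Q0p).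
have Qck k : ~ Q0 (c ^+ k) by move/(prime_idealX Q0p).
have Qckh k (h : {poly A}) : Q (c ^+ k *: h) -> Q h.
  by rewrite -mul_polyC => /(prime_idealP Qp)[/Qck|].
(* These are the members of (f) + Q outside [Q]. One of minimal size will be a constant [b], and the
   identity [b = f * u + w] carries nonvanishing from [b] to [f]. *)
pose F (e : {poly A}) := ~ Q e /\ exists u w, Q w /\ e = f * u + w.
have [|e [Qe [u [w [Qw eE]]]] emin] := @ex_min_size _ F.
  by exists f; split=> //; exists 1, 0; rewrite mulr1 addr0; split=> //; apply: (prime_ideal0 Qp).
have e0 : e != 0 by apply/eqP => e0; apply: Qe; rewrite e0; apply: (prime_ideal0 Qp).
have Fsmall (h u' w' : {poly A}) : (size h < size e)%N -> Q w' -> h = f * u' + w' -> Q h.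
  move=> lt_he Qw' hE; apply: contrapT => Qh.
  by move: lt_he; rewrite ltnNge => /negP; apply; apply: emin; split=> //; exists u', w'.
have lt_eg : (size e < size g)%N.
  rewrite ltnNge; apply/negP => le_ge; apply: Qe; apply: (@Qckh (scalp e g)).
  rewrite Pdiv.Idomain.divp_eq.
  apply: (prime_idealD Qp); first exact: (prime_idealMl Qp).
  apply: (@Fsmall _ (lead_coef g ^+ scalp e g *: u)
     (lead_coef g ^+ scalp e g *: w - e %/ g * g)).
  - by apply: leq_trans le_ge; rewrite Pdiv.Idomain.ltn_modp.
  - by apply: (prime_idealB Qp); [exact: QZ | exact: (prime_idealMl Qp)].
  - rewrite addrA -scalerAr -scalerDr -eE Pdiv.Idomain.divp_eq addrC addKr //.
(* Otherwise pseudo-divide [g] by [e]: the remainder and, by primality, the quotient lie in [Q] and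
   are smaller than [g], so their coefficients are in [Q0]. Comparing coefficients in the degree of
   [g] then puts [l ^+ k * c] in [Q0]. *)
have size_e : size e = 1%N.
  apply/eqP; rewrite eqn_leq size_poly_gt0 e0 andbT leqNgt; apply/negP => gt1e.
  pose l := lead_coef e.
  have Ql : ~ Q0 l.
    move=> Ql; apply: Qe; rewrite -[e](subrK (l *: 'X^((size e).-1))).
    apply: (prime_idealD Qp); last exact: Q0Z.
    apply: (@Fsmall _ u (w - l *: 'X^((size e).-1))); first exact: size_drop_lead.
      by apply: (prime_idealB Qp) => //; exact: Q0Z.
    by rewrite eE addrA.
  have dE := Pdiv.Idomain.divp_eq g e; rewrite -/l in dE.
  set k := scalp g e in dE; set v := g %/ e in dE; set r := g %% e in dE.
  have lt_re : (size r < size e)%N by rewrite Pdiv.Idomain.ltn_modp.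
  have Qr : Q r.
    apply: (@Fsmall r (- v * u) (l ^+ k *: g - v * w)) => //.
      by apply: (prime_idealB Qp); [exact: QZ | exact: (prime_idealMl Qp)].
    rewrite dE eE mulrDr [v * _ + v * _ + r]addrAC addrK mulNr mulrN mulrCA.
    by rewrite addKr.
  have lt_rg := ltn_trans lt_re lt_eg.
  have Qve : Q (v * e).
    rewrite -[v * e](addrK r) -dE.
    by apply: (prime_idealB Qp) => //; exact: QZ.
  have Qv : Q v by case: (prime_idealP Qp Qve).
  have lt_vg : (size v < size g)%N.
    have [->|v0] := eqVneq v 0; first by rewrite size_poly0 size_poly_gt0.
    have : (size (v * e)%R <= size g)%N.
      rewrite -[v * e](addrK r) -dE (leq_trans (size_polyD _ _)) // geq_max.
      by rewrite size_scale_leq size_polyN ltnW.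
    rewrite size_mul //; case: (size e) gt1e => [|[|s]] //= _.
    by rewrite !addnS; apply: leq_ltn_trans; exact: leq_addr.
  have [//|/(prime_idealX Q0p)//] : Q0 c \/ Q0 (l ^+ k).
  apply: (prime_idealP Q0p); rewrite mulrC.
  rewrite -[c]/(g`_(size g).-1) -coefZ dE coefD.
  apply: (prime_idealD Q0p); last exact: Qsmall.
  rewrite coefM; apply: (prime_ideal_sum Q0p) => i; rewrite mulrC.
  by apply: (prime_idealMl Q0p); apply: Qsmall.
have /size_poly1P[b _ eb] : size e == 1%N by rewrite size_e.
have Qbc : ~ Q0 (b * c).
  by move=> /(prime_idealP Q0p)[|//]; rewrite /Q0 -eb.
have [phi [phi_i phiQ]] := ptsA Q0 Q0p _ Qbc.
rewrite rmorphM mulf_eq0 negb_or => /andP[phib phic].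
(* The leading coefficient survives [phi], so a root can only be missing if [g] is constant; but a
   constant [g] would put [c] in [Q0]. *)
have size_g : (1 < size (map_poly phi g))%N.
  rewrite size_map_poly_id0 //; rewrite ltnNge; apply/negP => le_g1.
  by apply: Qc; rewrite /Q0 /c /lead_coef (size1_polyC le_g1) in Qg *; move: Qg;
    rewrite coefC; case: (_ == _) => //; rewrite ?size_polyC // => _; apply: (prime_ideal0 Q0p).
have /closed_rootP[t gt] : size (map_poly phi g) != 1%N.
  by rewrite neq_ltn size_g orbT.
have [psi psiE] := lift phi t.
have psiC a : psi a%:P = phi a by rewrite psiE map_polyC hornerC.
have psiQ (h : {poly A}) : Q h -> psi h = 0.
  move=> Qh; have dE := Pdiv.Idomain.divp_eq h g.
  have Qr : Q (h %% g).
    rewrite -[h %% g](addKr (h %/ g * g)) -dE addrC.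
    by apply: (prime_idealB Qp); [exact: QZ | exact: (prime_idealMl Qp)].
  have psir : psi (h %% g) = 0.
    rewrite psiE; suff -> : map_poly phi (h %% g) = 0 by rewrite horner0.
    apply/polyP => j; rewrite coef_map coef0; apply: phiQ; apply: Qsmall => //.
    by rewrite Pdiv.Idomain.ltn_modp.
  have := congr1 psi dE; rewrite rmorphD psir addr0 rmorphM (psiE g) (rootP gt) mulr0.
  rewrite -mul_polyC rmorphM psiC rmorphXn => /eqP.
  by rewrite mulf_eq0 expf_eq0 (negPf phic) andbF => /eqP.
exists psi; split=> [a||]; rewrite ?psiC //.
apply: contra_neq phib => psif.
by rewrite -psiC -eb eE rmorphD rmorphM psif mul0r psiQ // addr0.
Qed.

Lemma closed_points : has_points (@id K).
Proof.
move=> Q Qp f Qf; exists idfun; split=> // [h Qh|].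
  apply: contrapT => /eqP h0; apply: (prime_ideal1 Qp).
  by rewrite -(mulVf h0); apply: (prime_idealMl Qp).
by apply/eqP => /= f0; apply: Qf; rewrite f0; apply: (prime_ideal0 Qp).
Qed.

End Points.

Lemma mpoly_gen_ind (R : nzRingType) (n : nat) (S : {mpoly R[n]} -> Prop) :
  (forall c, S c%:MP) -> (forall i, S 'X_i) ->
  (forall f g, S f -> S g -> S (f + g)) ->
  (forall f g, S f -> S g -> S (f * g)) -> forall f, S f.
Proof.
move=> SC SX SD SM f; rewrite [f]mpolyE.
elim/big_rec: _ => [|m g _ Sg]; first by rewrite -mpolyC0.
apply: SD => //; rewrite -mul_mpolyC; apply: (SM) => //.
rewrite mpolyXE_id; apply: (big_ind S); [by rewrite -mpolyC1|exact: (SM)|] => i _.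
elim: (m i) => [|k IHk]; first by rewrite expr0 -mpolyC1.
by rewrite exprS; apply: SM.
Qed.

Lemma rmorph_mpolyE (K : fieldType) (n : nat) (phi : {rmorphism {mpoly K[n]} -> K}) :
  (forall c, phi c%:MP = c) -> forall f, phi f = f.@[fun i => phi 'X_i].
Proof.
move=> phiC; elim/mpoly_gen_ind => [c|i|f g IHf IHg|f g IHf IHg].
- by rewrite mevalC phiC.
- by rewrite mevalXU.
- by rewrite rmorphD mevalD IHf IHg.
- by rewrite rmorphM mevalM IHf IHg.
Qed.

Section Nullstellensatz.
Variable K : closedFieldType.

(** Induction on [n] along a surjection [pi] onto the ring in one more variable: the prime ideal is
    pulled back, and a point [psi] of the source factors through [pi], because it is determined by
    its values at the variables. *)
Lemma prime_points (n : nat) (Q : {mpoly K[n]} -> Prop) (f : {mpoly K[n]}) :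
  prime_ideal Q -> ~ Q f ->
  exists a : 'I_n -> K, (forall h, Q h -> h.@[a] = 0) /\ f.@[a] != 0.
Proof.
suff pts : has_points (fun c : K => c%:MP : {mpoly K[n]}).
  move=> Qp /(pts Q Qp)[phi [phiC phiQ phif]].
  exists (fun i => phi 'X_i); split=> [h Qh|]; rewrite -rmorph_mpolyE //.
  exact: phiQ.
elim: n {Q f} => [|n IHn].
  move=> Q Qp f Qf; pose phi : {rmorphism {mpoly K[0]} -> K} := meval (fun=> 0).
  have fC (h : {mpoly K[0]}) : h = (phi h)%:MP.
    elim/mpoly_gen_ind: h => [c|[]//|h g {1}-> {1}->|h g {1}-> {1}->].
    - by rewrite /phi /= mevalC.
    - by rewrite rmorphD mpolyCD.
    - by rewrite rmorphM mpolyCM.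
  have Q0p : prime_ideal (fun c => Q c%:MP).
    split.
    - exact: (prime_ideal0 Qp).
    - by move=> u v; rewrite mpolyCD; apply: (prime_idealD Qp).
    - by move=> a u; rewrite mpolyCM; apply: (prime_idealMl Qp).
    - exact: (prime_ideal1 Qp).
    - by move=> u v; rewrite mpolyCM; apply: (prime_idealP Qp).
  have Qf' : ~ Q (phi f)%:MP by rewrite -fC.
  have [psi [psiC psiQ psif]] := closed_points Q0p Qf'.
  exists phi; split=> [c|h|]; first by rewrite /phi /= mevalC.
    by rewrite {1}[h]fC => /psiQ; rewrite psiC.
  by rewrite psiC in psif.
pose pi : {rmorphism {poly {mpoly K[n]}} -> {mpoly K[n.+1]}} :=
  horner_eval 'X_ord_max \o @mpwiden n K.
have piC c : pi c%:MP%:P = c%:MP.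
  by rewrite /pi /= mpwidenC mwidenC /horner_eval hornerC.
have pi_surj f : exists h, pi h = f.
  elim/mpoly_gen_ind: f => [c|i|f g [h <-] [h' <-]|f g [h <-] [h' <-]].
  - by exists c%:MP%:P.
  - case: (unliftP ord_max i) => [j|] ->.
      exists ('X_j)%:P; rewrite /pi /= mpwidenC /horner_eval hornerC mwidenX mnmwiden1.
      by congr ('X_[U_(_)]); apply: val_inj; rewrite /= /bump leqNgt ltn_ord.
    by exists 'X; rewrite /pi /= mpwidenX /horner_eval hornerX.
  - by exists (h + h'); rewrite rmorphD.
  - by exists (h * h'); rewrite rmorphM.
move=> Q Qp f Qf; have [f' pif] := pi_surj f.
have Q'p : prime_ideal (fun h => Q (pi h)).
  split.
  - by rewrite rmorph0; apply: (prime_ideal0 Qp).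
  - by move=> u v; rewrite rmorphD; apply: (prime_idealD Qp).
  - by move=> a u; rewrite rmorphM; apply: (prime_idealMl Qp).
  - by rewrite rmorph1; apply: (prime_ideal1 Qp).
  - by move=> u v; rewrite rmorphM; apply: (prime_idealP Qp).
have Qf' : ~ Q (pi f') by rewrite pif.
have [psi [psiC psiQ psif]] := has_points_poly IHn Q'p Qf'.
have piE h : psi h = (pi h).@[fun i => if unlift ord_max i is Some j then psi ('X_j)%:P else psi 'X].
  elim/poly_ind: h => [|h c IHh]; first by rewrite !rmorph0.
  rewrite !rmorphD !rmorphM IHh; congr (_ * _ + _).
    by rewrite /pi /= mpwidenX /horner_eval hornerX mevalXU unlift_none.
  rewrite /pi /= mpwidenC /horner_eval hornerC.
  elim/mpoly_gen_ind: c => [c|i|g g' IHg IHg'|g g' IHg IHg'].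
  - by rewrite psiC mwidenC mevalC.
  - rewrite mwidenX mnmwiden1 mevalXU.
    have -> : widen_ord (leqnSn n) i = fintype.lift ord_max i.
      by apply: val_inj; rewrite /= /bump leqNgt ltn_ord.
    by rewrite liftK.
  - by rewrite polyCD !rmorphD IHg IHg'.
  - by rewrite polyCM !rmorphM IHg IHg'.
exists (meval (fun i => if unlift ord_max i is Some j then psi ('X_j)%:P else psi 'X)).
split=> [c|h Qh|]; first by rewrite /= mevalC.
  have [h' pih] := pi_surj h; rewrite -pih in Qh *.
  by have := psiQ h' Qh; rewrite piE.
by rewrite -pif; move: psif; rewrite piE.
Qed.

(* Zorn: an ideal maximal among those containing [I0] but not [1] is prime. *)
Lemma proper_ideal_zero (n : nat) (I0 : set {mpoly K[n]}) :
  I0 0 -> (forall u v, I0 u -> I0 v -> I0 (u + v)) ->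
  (forall a u, I0 u -> I0 (a * u)) -> ~ I0 1 ->
  exists a, forall f, I0 f -> f.@[a] = 0.
Proof.
move=> I00 I0D I0M I01.
pose ideal (I : set {mpoly K[n]}) :=
  [/\ I 0, forall u v, I u -> I v -> I (u + v) & forall a u, I u -> I (a * u)].
have idI0 : ideal I0 by [].
(* The order is on sets whose union with [I0] is a proper ideal, rather than on ideals containing
   [I0], so that the empty chain also has an admissible union. *)
have [C tot|A [[idA A1] maxA]] :=
    @Zorn_bigcup {mpoly K[n]} (fun X => ideal (X `|` I0) /\ ~ (X `|` I0) 1).
  move=> Ctot; have [[X0 CX0]|C0] := pselect (exists X, C X); last first.
    have -> : \bigcup_(X in C) X = set0.
      by apply/seteqP; split=> // x [X CX]; case: C0; exists X.
    by rewrite set0U.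
  split; last first.
    by case=> [[X CX X1]|//]; case: (tot _ CX) => _; apply; left.
  have sub X : C X -> X `|` I0 `<=` (\bigcup_(X in C) X) `|` I0.
    by move=> CX x [Xx|]; [left; exists X|right].
  have up u : (\bigcup_(X in C) X `|` I0) u -> exists2 X, C X & (X `|` I0) u.
    by case=> [[X CX Xu]|Iu]; [exists X => //; left|exists X0 => //; right].
  split; first by right; case: (idI0).
    move=> u v /up[X CX Xu] /up[Y CY Yv].
    have [XY|YX] := Ctot _ _ CX CY.
      apply: (sub Y) => //; case: (tot _ CY) => [[_ YD _] _].
      by apply: YD => //; case: Xu => [/XY|]; [left|right].
    apply: (sub X) => //; case: (tot _ CX) => [[_ XD _] _].
    by apply: XD => //; case: Yv => [/YX|]; [left|right].
  move=> a u /up[X CX Xu]; apply: (sub X) => //.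
  by case: (tot _ CX) => [[_ _ XM] _]; apply: XM.
pose Q := A `|` I0; have [Q0 QD QM] : ideal Q by [].
have Qext u : ~ Q u -> exists2 w, Q w & exists a, w + a * u = 1.
  move=> Qu; pose B : set {mpoly K[n]} := [set f | exists2 w, Q w & exists a, f = w + a * u].
  have AB : A `<` B.
    split; first by move=> x Ax; exists x; [left|exists 0; rewrite mul0r addr0].
    move=> BA; apply: Qu; left; apply: BA.
    by exists 0 => //; exists 1; rewrite mul1r add0r.
  have IB : I0 `<=` B by move=> x Ix; exists x; [right|exists 0; rewrite mul0r addr0].
  have BI : B `|` I0 = B by apply/seteqP; split=> x; [case=> // /IB|left].
  have := maxA _ AB; rewrite BI => nB.
  apply: contrapT => no; apply: nB; split; last first.
    by case=> w Qw [a aE]; apply: no; exists w => //; exists a.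
  split.
  - by apply: IB; case: (idI0).
  - move=> _ _ [w Qw [a ->]] [w' Qw' [a' ->]]; exists (w + w'); first exact: QD.
    by exists (a + a'); rewrite mulrDl addrACA.
  - move=> b _ [w Qw [a ->]]; exists (b * w); first exact: QM.
    by exists (b * a); rewrite mulrDr mulrA.
have Qp : prime_ideal Q.
  split=> // u v Quv; apply: contrapT => /not_orP[/Qext[w Qw [a wa]] /Qext[w' Qw' [a' wa']]].
  apply: A1; rewrite -[1]mulr1 -{1}wa -wa'.
  have -> : (w + a * u) * (w' + a' * v) = (w' + a' * v) * w + (a * u) * w' + (a * a') * (u * v).
    by rewrite mulrDl (mulrDr (a * u)) (mulrACA a u) [w * _]mulrC addrA.
  by apply: (QD); [apply: (QD)|]; apply: (QM).
have [a [aQ _]] := prime_points Qp A1.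
by exists a => f If; apply: aQ; right.
Qed.

Lemma weak_nullstellensatz (n : nat) (J : finType) (F : J -> {mpoly K[n]}) :
  (forall a, exists j, (F j).@[a] != 0) ->
  exists g : J -> {mpoly K[n]}, \sum_j g j * F j = 1.
Proof.
move=> noz; apply: contrapT => no1.
have [|_ _ [g ->] [h ->]|a _ [g ->]|[g g1]|a aF] := @proper_ideal_zero n
    [set f | exists g : J -> {mpoly K[n]}, f = \sum_j g j * F j].
- by exists (fun=> 0); rewrite big1 // => j _; rewrite mul0r.
- exists (fun j => g j + h j).
  by rewrite -big_split; apply: eq_bigr => j _; rewrite mulrDl.
- exists (fun j => a * g j).
  by rewrite mulr_sumr; apply: eq_bigr => j _; rewrite mulrA.
- by apply: no1; exists g.
have [j /eqP] := noz a; apply; apply: aF.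
exists (fun i => (i == j)%:R); rewrite (bigD1 j) //= eqxx mul1r big1 ?addr0 // => i /negPf->.
by rewrite mul0r.
Qed.

(** The adjugate of each maximal square submatrix inverts it up to its minor; weighting these by
    Bezout coefficients of the minors gives [C]. Rows are selected by arbitrary functions [h]: a
    non-injective one only adds a zero minor. *)
Lemma left_inverse_of_points (n r s : nat) (E : 'M[{mpoly K[n]}]_(s, r)) :
  (forall a : 'I_n -> K, row_full (map_mx (meval a) E)) ->
  exists C : 'M_(r, s), C *m E = 1%:M.
Proof.
move=> fullE.
pose F (h : {ffun 'I_r -> 'I_s}) := \det (rowsub h E).
have [a|g g1] := @weak_nullstellensatz n {ffun 'I_r -> 'I_s} F.
  have := mxrank_fullrowsub (fullE a); set h := fullrankfun _ => rk.
  exists (finfun h); rewrite /F.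
  rewrite -[_.@[a]]/(meval a (\det _)) -det_map_mx -unitfE -unitmxE -row_full_unit /row_full.
  apply/eqP; apply: etrans rk; congr (\rank _).
  by apply/matrixP => i j; rewrite !mxE ffunE.
exists (\sum_h g h *: (\adj (rowsub h E) *m rowsub h 1%:M)).
rewrite mulmx_suml -[1%:M]/(1%:M) -{2}g1.
transitivity (\sum_h (g h * F h)%:M : 'M[{mpoly K[n]}]_r); last by rewrite raddf_sum.
apply: eq_bigr => h _; rewrite -scalemxAl -mulmxA mul_rowsub_mx mul1mx.
by rewrite mul_adj_mx scale_scalar_mx.
Qed.

End Nullstellensatz.

(** * Maximal ideals of the polynomial ring as points *)

Section PointIdeals.
Variables (K : closedFieldType) (n : nat).
Local Notation P := {mpoly K[n]}.
Implicit Types (a : 'I_n -> K) (f : P).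

Lemma mem_point_ideal_var a i : 'X_i - (a i)%:MP \in point_ideal a.
Proof.
apply/point_ideal_predP; exists (fun j => (j == i)%:R).
by rewrite (bigD1 i) //= eqxx mul1r big1 ?addr0 // => j /negPf->; rewrite mul0r.
Qed.

Lemma point_ideal_meval a f : f - (f.@[a])%:MP \in point_ideal a.
Proof.
elim/mpoly_gen_ind: f => [c|i|f g IHf IHg|f g IHf IHg].
- by rewrite mevalC subrr rpred0.
- by rewrite mevalXU mem_point_ideal_var.
- by rewrite mevalD mpolyCD opprD addrACA rpredD.
- rewrite mevalM mpolyCM -[f * g](subrK (f * (g.@[a])%:MP)) -addrA -mulrBr -mulrBl.
  by rewrite rpredD // ?[_ * (g.@[a])%:MP]mulrC idealMr.
Qed.

Lemma mem_point_ideal a f : (f \in point_ideal a) = (f.@[a] == 0).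
Proof.
apply/idP/eqP => [/point_ideal_predP[g ->]|fa].
  rewrite raddf_sum big1 // => i _.
  by rewrite /= mevalM mevalB mevalXU mevalC subrr mulr0.
by have := point_ideal_meval a f; rewrite fa mpolyC0 subr0.
Qed.

Lemma point_ideal_inj a b : point_ideal a = point_ideal b -> a = b.
Proof.
move=> ab; apply/funext => i; have := mem_point_ideal_var a i.
rewrite ab mem_point_ideal mevalB mevalXU mevalC subr_eq0 => /eqP//.
Qed.

Lemma point_ideal_maximal a : maximal_idealr (point_ideal a).
Proof.
move=> J aJ; apply: idealr_eqP => f; apply/idP/idP => [Jf|/aJ//].
rewrite mem_point_ideal; apply/negPn/negP => fa0.
have : (f.@[a])%:MP \in J.
  by rewrite -[X in X \in _](subKr f) rpredB // aJ // point_ideal_meval.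
move/(idealMr (f.@[a])^-1%:MP).
by rewrite -mpolyCM mulVf // mpolyC1 idealr1.
Qed.

Lemma maximal_point_ideal (m : idealr P) : maximal_idealr m -> exists a, m = point_ideal a.
Proof.
move=> max_m.
have [|u v|c u||a am] := @proper_ideal_zero K n [set f | f \in m]; rewrite /= ?rpred0 //.
- exact: rpredD.
- exact: idealMr.
- by rewrite idealr1.
exists a; apply/esym/max_m => f mf.
by rewrite mem_point_ideal am.
Qed.

End PointIdeals.

(** * Differential operators in characteristic p *)

(** From [j * 'C(q, j) = q * 'C(q.-1, j.-1)] with [q = p ^ e]: if [p] did not divide the binomial,
    [q] would divide [j]. *)
Lemma dvdn_bin_pexp (p e j : nat) : prime p -> (0 < j < p ^ e)%N -> (p %| 'C(p ^ e, j))%N.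
Proof.
move=> p_pr; case: j => // j /= lt_jq; apply: contraLR lt_jq => pC.
rewrite -leqNgt dvdn_leq // -(@Gauss_dvdl _ _ 'C(p ^ e, j.+1)); last first.
  by rewrite coprimeXl // prime_coprime.
by rewrite -mul_bin_diag dvdn_mulr.
Qed.

Section BinomialCharp.
Variables (K : fieldType) (p : nat) (hp : p \in [pchar K]) (e : nat).
Local Notation q := (p ^ e)%N.

Lemma binq_eq0 j : (0 < j < q)%N -> 'C(q, j)%:R = 0 :> K.
Proof.
move=> /(dvdn_bin_pexp (pcharf_prime hp)) /dvdnP[k ->].
by rewrite natrM (pcharf0 hp) mulr0.
Qed.

(** In Vandermonde's formula only the term with ['C(q, 0)] survives in [K]. Iterated, this is the
    part of Lucas's theorem used here: for [j < q], the binomial depends only on the residue of [m]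
    modulo [q]. *)
Lemma bin_addq m j : (j < q)%N -> 'C(q + m, j)%:R = 'C(m, j)%:R :> K.
Proof.
move=> lt_jq; rewrite -binomial.Vandermonde natr_sum big_ord_recl bin0 mul1n subn0.
rewrite big1 ?addr0 // => i _; rewrite natrM binq_eq0 ?mul0r //=.
by rewrite /bump /= (leq_ltn_trans _ lt_jq).
Qed.

Lemma bin_modq m j : (j < q)%N -> 'C(m, j)%:R = 'C(m %% q, j)%:R :> K.
Proof.
move=> lt_jq; rewrite {1}(divn_eq m q).
elim: (m %/ q)%N => [|k IHk]; first by rewrite mul0n.
by rewrite mulSn -addnA bin_addq.
Qed.

End BinomialCharp.

(** Left multiplication by [x] is the sum of the commutator with [x] and right multiplication by
    [x]. These two commute, so this is the binomial theorem for their sum. *)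
Lemma expr_comm_sum (R : pzRingType) (x u : R) m :
  x ^+ m * u =
  \sum_(j < m.+1) (iter j (fun v => x * v - v * x) u * x ^+ (m - j)) *+ 'C(m, j).
Proof.
set ad := (fun v : R => x * v - v * x); have adE v : x * v = ad v + v * x by rewrite /ad subrK.
elim: m => [|m IHm]; first by rewrite big_ord1 mulr1 mul1r.
rewrite exprS -mulrA IHm mulr_sumr.
under eq_bigr => j _.
  rewrite mulrnAr mulrA adE mulrDl mulrnDl -[_ * x * _]mulrA -exprS -[ad _]iterS.
  over.
rewrite big_split /= [RHS]big_ord_recl [X in _ + X]big_ord_recl addrCA !bin0 !subn0.
congr (_ + _).
transitivity (\sum_(j < m.+1) (iter j.+1 ad u * x ^+ (m - j)) *+ 'C(m, j) +
    \sum_(j < m.+1) (iter j.+1 ad u * x ^+ (m - j)) *+ 'C(m, j.+1)).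
  congr (_ + _); rewrite [RHS]big_ord_recr /= bin_small // mulr0n addr0.
  by apply: eq_bigr => j _; rewrite /bump /= add1n subnSK.
rewrite -big_split; apply: eq_bigr => j _ /=.
by rewrite /bump /= !add1n subSS -mulrnDr addnC -binS.
Qed.

Lemma diffop_of_order_iter (K : fieldType) (A : comAlgType K) k (u : endo A) a j :
  diffop_of_order k u -> (k < j)%N -> iter j (comm_op a) u = 0.
Proof.
elim: j k u => // j IHj [|k] u Hu lt_kj; rewrite iterSr; last exact: (IHj k).
rewrite (Hu a); elim: j {IHj lt_kj} => //= j ->.
by rewrite /comm_op mulr0 mul0r subrr.
Qed.

(* [ad (a ^+ q) = (ad a) ^+ q] kills the operators of order less than [q].     *)
Lemma diffop_of_order_lin (K : fieldType) (p : nat) (hp : p \in [pchar K]) e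
    (A : comAlgType K) k (u : endo A) :
  diffop_of_order k u -> (k < p ^ e)%N ->
  forall a f, u (a ^+ (p ^ e) * f) = a ^+ (p ^ e) * u f.
Proof.
move=> Hu lt_kq a f; set q := (p ^ e)%N in lt_kq *.
have XE m g : ((mulop a : endo A) ^+ m) g = a ^+ m * g.
  elim: m g => [|m IHm] g; first by rewrite !expr0 mul1r.
  by rewrite exprS endoME IHm mulopE exprS mulrA.
have q0 : (0 < q)%N by exact: leq_ltn_trans lt_kq.
have nat0 (v : endo A) (m : nat) : m%:R = 0 :> K -> v *+ m = 0.
  move=> m0; apply: endoP => g.
  have -> : (v *+ m) g = v g *+ m.
    by elim: m {m0} => [|m IHm]; rewrite ?mulr0n // !mulrS endoDE IHm.
  by rewrite -scaler_nat m0 scale0r.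
have := expr_comm_sum (mulop a) u q.
(* Past the first term, the middle ones carry binomials that vanish in [K], and the last one is [u]
   after [q] commutators, more than its order allows. *)
rewrite big_ord_recl [X in _ + X]big1 ?addr0 => [|j _]; last first.
  rewrite lift0; have [lt_jq|] := ltnP j.+1 q.
    by rewrite nat0 // binq_eq0.
  rewrite leq_eqVlt ltnS => /predU1P[<-|]; last first.
    by rewrite leqNgt ltn_ord.
  by rewrite (diffop_of_order_iter a Hu lt_kq) mul0r mul0rn.
rewrite bin0 subn0 mulr1n => /(congr1 (fun v : endo A => v f)) E.
by have := E; rewrite -[LHS]/((mulop a ^+ q : endo A) (u f)) -[RHS]/(u ((mulop a ^+ q : endo A) f)) !XE.
Qed.

Definition dapp (K : fieldType) (A : comAlgType K) (u : diffops A) : {linear A -> A} :=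
  diffop_val u.

(** * The polynomial ring as a free module over the polynomials in the x_i^q *)

Section Trace.
Variables (K : fieldType) (p : nat) (hp : p \in [pchar K]) (n e : nat).
Local Notation P := {mpoly K[n]}.
Local Notation D := (diffops {mpoly K[n]}).
Local Notation q := (p ^ e)%N.

Let q_gt0 : (0 < q)%N.
Proof. by rewrite expn_gt0 prime_gt0 // (pcharf_prime hp). Qed.

Lemma diffopME (u v : D) (f : P) : dapp (u * v) f = dapp u (dapp v f). Proof. by []. Qed.
Lemma diffopDE (u v : D) (f : P) : dapp (u + v) f = dapp u f + dapp v f. Proof. by []. Qed.
Lemma mul_diffopE (g f : P) : dapp (mul_diffop g) f = g * f. Proof. by []. Qed.

Lemma dapp_sum (I : Type) (r : seq I) (S : pred I) (F : I -> P) (u : D) :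
  dapp u (\sum_(i <- r | S i) F i) = \sum_(i <- r | S i) dapp u (F i).
Proof. exact: raddf_sum. Qed.

Lemma diffop_sumE (I : Type) (r : seq I) (S : pred I) (u : I -> D) f :
  dapp (\sum_(i <- r | S i) u i) f = \sum_(i <- r | S i) dapp (u i) f.
Proof. by elim/big_rec2: _ => // b x v _ E; rewrite diffopDE E. Qed.

Lemma diffop_eq (u v : D) : (forall f, dapp u f = dapp v f) -> u = v.
Proof. by move=> uv; apply: val_inj; apply: endoP. Qed.

Lemma dpowsX (b m : 'X_{1..n}) :
  dapp (dpows K b) 'X_[m] = (\prod_i 'C(m i, b i))%:R *: 'X_[m - b].
Proof.
rewrite /dpows.
have -> : 'X_[m - b] = 'X_[m - (\sum_(i <- index_enum 'I_n) U_(i) *+ b i)%MM] :> P.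
  by congr 'X_[m - _]; apply/mnmP => i; rewrite {1}(multinomUE_id b).
(* Since the indices are distinct, the factors already applied have left the exponent at [i]
   unchanged. *)
have : uniq (index_enum 'I_n) by exact: index_enum_uniq.
elim: (index_enum 'I_n) => [|i s IHs] /=.
  by move=> _; rewrite !big_nil scale1r; congr ('X_[_]); apply/mnmP => j; rewrite mnmBE mnm0E subn0.
case/andP=> i_s uniq_s.
rewrite !big_cons diffopME IHs // linearZ /= [dapp (dpow _ _ _) _]dpow_funX scalerA -natrM mulnC.
have sumi : (\sum_(i0 <- s) U_(i0) *+ b i0)%MM i = 0%N.
  rewrite mnm_sumE big_seq big1 // => j js; rewrite mulmnE mnm1E.
  by case: eqP js i_s => [->|//] ->.
rewrite mnmBE sumi subn0; congr (_ *: 'X_[_]); apply/mnmP => j.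
by rewrite !(mnmBE, mnmDE) addnC subnDA.
Qed.

Definition top : 'X_{1..n} := [multinom q.-1 | i < n].
(** For the monomial basis with exponents below [q], this is the coordinate along ['X_[top]]: a
    Cartier operator, without the extraction of q-th roots. *)
Definition trace : D := dpows K top.

Lemma traceX m :
  dapp trace 'X_[m] = (if [forall i, (m i %% q == q.-1)%N] then 'X_[m - top] else 0) :> P.
Proof.
rewrite /trace dpowsX natr_prod.
case: forallP => [mtop|ntop].
  rewrite big1 ?scale1r // => i _.
  by rewrite mnmE (bin_modq hp (e := e)) ?ltn_predL // (eqP (mtop i)) binn.
have [i mi] : exists i, (m i %% q != q.-1)%N.
  by apply/existsP; rewrite -negb_forall; apply/forallP.
rewrite (bigD1 i) //= mnmE (bin_modq hp (e := e)) ?ltn_predL // bin_small ?mul0r ?scale0r //.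
by rewrite ltn_neqAle mi -ltnS prednK // ltn_mod.
Qed.

Lemma trace_lin a f : dapp trace (a ^+ q * f) = a ^+ q * dapp trace f :> P.
Proof.
rewrite /trace /dpows; elim/big_rec: _ f => [//|i u _ IHu] f.
rewrite diffopME IHu diffopME.
have lt_q : (top i < q)%N by rewrite mnmE ltn_predL.
exact: (diffop_of_order_lin hp (@dpow_op_order K n i (top i)) lt_q a (dapp u f)).
Qed.

(** The relative Frobenius: coefficients stay fixed, so K-linear operators commuting with q-th
    powers are linear over its image. *)
Definition frob : {rmorphism P -> P} := comp_mpoly [tuple 'X_i ^+ q | i < n].

Lemma frobX m : frob 'X_[m] = 'X_[m] ^+ q.
Proof.
rewrite /frob /= comp_mpolyX [in RHS]mpolyXE_id -prodrXl; apply: eq_bigr => i _.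
by rewrite tnth_mktuple exprAC.
Qed.

Lemma frobC c : frob c%:MP = c%:MP. Proof. exact: comp_mpolyC. Qed.

Lemma meval_frob a h : (frob h).@[a] = h.@[fun i => a i ^+ q].
Proof.
rewrite /frob /= comp_mpoly_meval; congr (_.@[_]); apply/funext => i.
by rewrite tnth_mktuple rmorphXn /= mevalXU.
Qed.

Definition qlin (u : D) : Prop := forall a f, dapp u (a ^+ q * f) = a ^+ q * dapp u f.

Lemma qlin_frob (u : D) : qlin u -> forall h f, dapp u (frob h * f) = frob h * dapp u f.
Proof.
move=> ulin h f; rewrite [h]mpolyE raddf_sum !mulr_suml raddf_sum; apply: eq_bigr => m _ /=.
by rewrite -mul_mpolyC rmorphM /= frobC frobX mul_mpolyC -!scalerAl linearZ /= ulin.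
Qed.

Lemma trace_frob f : exists h, dapp trace f = frob h.
Proof.
rewrite [f]mpolyE raddf_sum; elim/big_rec: _ => [|m g _ [h ->]].
  by exists 0; rewrite rmorph0.
rewrite /= linearZ /= traceX; case: forallP => [mtop|_]; last first.
  by exists h; rewrite scaler0 add0r.
exists ((f@_m)%:MP * 'X_[[multinom (m i %/ q)%N | i < n]] + h).
rewrite rmorphD rmorphM /= frobC frobX mul_mpolyC; congr (_ *: _ + _).
rewrite mpolyXn; congr ('X_[_]); apply/mnmP => i; rewrite mnmBE mulmnE !mnmE.
by rewrite {1}(divn_eq (m i) q) (eqP (mtop i)) addnK mulnC.
Qed.

Definition box : finType := {ffun 'I_n -> 'I_q}.
Definition boxm (b : box) : 'X_{1..n} := [multinom b i : nat | i < n].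
(** The complementary exponents give the dual basis: for the pairing that sends f, g to T(fg),
    ['X_[cobox b]] is dual to ['X_[boxm b]]. *)
Definition cobox (b : box) : 'X_{1..n} := [multinom (q.-1 - b i)%N | i < n].

Lemma trace_box_monomial (b : box) m :
  dapp trace ('X_[cobox b] * 'X_[m]) =
  if [forall i, (b i == m i %% q :> nat)%N] then 'X_[m - boxm b] else 0 :> P.
Proof.
rewrite -mpolyXD traceX.
have -> : [forall i, ((cobox b + m)%MM i %% q == q.-1)%N] = [forall i, (b i == m i %% q :> nat)%N].
  apply: eq_forallb => i; rewrite mnmDE mnmE.
  have le_b : (b i <= q.-1)%N by rewrite -ltnS prednK.
  have -> : ((q.-1 - b i + m i) %% q == q.-1)%N = (m i == b i %[mod q])%N.
    rewrite -(eqn_modDl (q.-1 - b i)) subnK // [in RHS](@modn_small q.-1) ?ltn_predL //.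
  by rewrite eq_sym [(b i %% q)%N]modn_small.
case: forallP => // bm; congr ('X_[_]); apply/mnmP => i.
rewrite !(mnmBE, mnmDE, mnmE).
have le_b : (b i <= q.-1)%N by rewrite -ltnS prednK.
by rewrite -{2}(subnK le_b) subnDl.
Qed.

Lemma trace_box (b c : box) : dapp trace ('X_[cobox b] * 'X_[boxm c]) = (b == c)%:R :> P.
Proof.
rewrite trace_box_monomial; case: forallP => [bc|nbc].
  have -> : b = c.
    by apply/ffunP => i; apply: val_inj; rewrite /= (eqP (bc i)) mnmE modn_small.
  rewrite eqxx; have -> : (boxm c - boxm c = 0)%MM by apply/mnmP => i; rewrite mnmBE subnn mnm0E.
  by rewrite mpolyX0.
case: eqP => // bc; case: nbc => i.
by rewrite bc mnmE modn_small.
Qed.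

Lemma trace_expand f : f = \sum_(b : box) dapp trace ('X_[cobox b] * f) * 'X_[boxm b].
Proof.
rewrite {1}[f]mpolyE.
under [RHS]eq_bigr => b _ do rewrite {1}[f]mpolyE mulr_sumr raddf_sum mulr_suml.
rewrite exchange_big; apply: eq_bigr => m _ /=.
pose b0 : box := [ffun i => Ordinal (ltn_pmod (m i) q_gt0)].
rewrite (bigD1 b0) //= big1 => [|b bb0].
  rewrite -scalerAr linearZ /= trace_box_monomial.
  have -> : [forall i, (b0 i == m i %% q :> nat)%N] by apply/forallP => i; rewrite ffunE.
  rewrite -scalerAl -mpolyXD addr0; congr (_ *: 'X_[_]); apply/mnmP => i.
  by rewrite mnmDE mnmBE mnmE ffunE subnK // leq_mod.
rewrite -scalerAr linearZ /= trace_box_monomial.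
case: forallP => [bm|_]; last by rewrite scaler0 mul0r.
case/eqP: bb0; apply/ffunP => i; apply: val_inj.
by rewrite ffunE /= (eqP (bm i)).
Qed.

Lemma qlin_trace (u : D) : qlin u -> u * trace = mul_diffop (dapp u 1) * trace.
Proof.
move=> ulin; apply: diffop_eq => f; have [h Th] := trace_frob f.
by rewrite !diffopME mul_diffopE Th -[frob h]mulr1 qlin_frob // mulr1 mulrC.
Qed.

(** Apply [u] to the dual basis expansion; the coordinates are values of T and pass through [u]. In
    this form the operator can be evaluated on delta, where the rightmost factor acts by a
    scalar. *)
Lemma qlin_expand (u : D) : qlin u ->
  u = \sum_(b : box) mul_diffop (dapp u 'X_[boxm b]) * trace * mul_diffop 'X_[cobox b].
Proof.
move=> ulin; apply: diffop_eq => f.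
rewrite diffop_sumE {1}[f]trace_expand dapp_sum; apply: eq_bigr => b _.
rewrite !diffopME !mul_diffopE; have [h ->] := trace_frob ('X_[cobox b] * f).
by rewrite qlin_frob // mulrC.
Qed.

End Trace.

(** * Tensor products and spans *)

Section TensorTheory.
Variables (A : zmodType) (S : pzRingType) (ract : A -> S -> A) (B : lmodType S).
Local Notation F := (tensor_free A B).
Local Notation N := (span_pred (tensor_rel ract (B := B))).
Local Notation Q := {ideal_quot N}.
Local Notation T := (tensor ract B).

Lemma tensor_rel_eq (x y : F) : tensor_rel ract (x - y) ->
  \pi_Q%qT x = \pi_Q%qT y.
Proof.
move=> xy; apply/eqP; rewrite -Quotient.idealrBE; apply/span_predP.
by exists 1%N, (fun=> 1), (fun=> x - y); rewrite big_ord1 scale1r.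
Qed.

Lemma tensDl a a' b : tens ract (a + a') b = tens ract a b + tens ract a' b :> T.
Proof.
rewrite /tens -[RHS]raddfD; apply: tensor_rel_eq.
by apply: Or31; exists a, a', b.
Qed.

Lemma tensDr a b b' : tens ract a (b + b') = tens ract a b + tens ract a b' :> T.
Proof.
rewrite /tens -[RHS]raddfD; apply: tensor_rel_eq.
by apply: Or32; exists a, b, b'.
Qed.

Lemma tens_bal a s b : tens ract (ract a s) b = tens ract a (s *: b) :> T.
Proof. by apply: tensor_rel_eq; apply: Or33; exists a, s, b. Qed.

Lemma tensor_ind (R : T -> Prop) :
  R 0 -> (forall x y, R x -> R y -> R (x - y)) ->
  (forall a b, R (tens ract a b)) -> forall x, R x.
Proof.
move=> R0 RB Rt x.
have RD u v : R u -> R v -> R (u + v).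
  by move=> Ru Rv; rewrite -[v]opprK -[- v]sub0r; apply: (RB) => //; apply: (RB).
have Rz (u : T) k : R u -> R (u *~ k).
  move=> Ru; have Rn j : R (u *+ j).
    by elim: j => [|j IHj]; rewrite ?mulr0n // mulrS; apply: RD.
  case: k => k; first by rewrite -pmulrn.
  by rewrite NegzE mulrNz -pmulrn -sub0r; apply: (RB).
rewrite -[x](reprK (x : Q)).
pose z : {freeg (A * B)%type} := repr (x : Q).
rewrite -[repr _](freeg_sumE z) raddf_sum; elim/big_rec: _ => // ab u _ Ru.
apply: (RD) => //; rewrite -[coeff ab z]intz -freegU_mulz raddfMz.
by case: ab => a b; apply: Rz; apply: Rt.
Qed.

(** The universal property, the only way to detect that an element of the quotient is nonzero. *)
Lemma tensor_lift (Z : zmodType) (g : A -> B -> Z) :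
  (forall a a' b, g (a + a') b = g a b + g a' b) ->
  (forall a b b', g a (b + b') = g a b + g a b') ->
  (forall a s b, g (ract a s) b = g a (s *: b)) ->
  exists f : {additive T -> Z}, forall a b, f (tens ract a b) = g a b.
Proof.
move=> gDl gDr gbal.
(* [zmodule Z] is [Z] seen as a module over the integers, as lifting from the free abelian group
   requires. *)
pose G : F -> zmodule Z := fglift (fun ab => g ab.1 ab.2 : zmodule Z).
have GB x y : G (x - y) = G x - G y by exact: lift_is_additive.
have G0 : G 0 = 0 by rewrite -(subrr 0) GB subrr.
have GD x y : G (x + y) = G x + G y.
  by rewrite -{1}[y]opprK GB -[- y]sub0r GB G0 sub0r opprK.
have Gt a b : G (tensor_gen a b) = g a b by rewrite /G /tensor_gen liftU scale1r.
have GN z : z \in N -> G z = 0.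
  case/span_predP => m [c [x [Xx ->]]].
  elim/big_rec: _ => // i y _ Gy; rewrite GD Gy addr0.
  have Gx : G (x i) = 0.
    case: (Xx i) => [[a [a' [b ->]]]|[a [b [b' ->]]]|[a [s [b ->]]]];
      by rewrite GB ?GD !Gt (gDl, gDr, gbal) subrr.
  rewrite -[c i]intz scaler_int.
  have Gn j : G (x i *+ j) = 0 by elim: j => [|j IHj]; rewrite ?mulr0n // mulrS GD Gx add0r.
  by case: (c i) => k; rewrite -?pmulrn // NegzE mulrNz -pmulrn -sub0r GB G0 Gn subrr.
pose f (x : T) : Z := G (repr (x : Q)).
have fpi z : f (\pi_Q%qT z) = G z.
  apply/eqP; rewrite /f -subr_eq0 -GB; apply/eqP/GN.
  by rewrite Quotient.idealrBE reprK.
have fB : zmod_morphism f.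
  move=> x y; rewrite -[x](reprK (x : Q)) -[y](reprK (y : Q)) -[X in f X]raddfB.
  by rewrite !fpi GB.
pose fM := GRing.isZmodMorphism.Build T Z f fB.
pose fA : {additive T -> Z} := HB.pack f fM.
by exists fA => a b; rewrite /= fpi Gt.
Qed.

End TensorTheory.

Section SpanTheory.
Variables (R : pzRingType) (V : lmodType R).

Lemma mem_span (X : set V) x : X x -> x \in span_pred X.
Proof.
by move=> Xx; apply/span_predP; exists 1%N, (fun=> 1), (fun=> x); rewrite big_ord1 scale1r.
Qed.

Lemma span_subset (X : set V) (S : submodClosed V) :
  (forall x, X x -> x \in S) -> {subset span_pred X <= S}.
Proof.
move=> XS _ /span_predP[r [c [x [Xx ->]]]].
by apply: rpred_sum => i _; apply: rpredZ; apply: XS.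
Qed.

Lemma span_finP (I : finType) (v : I -> V) x :
  x \in span_pred (range v) <-> exists c : I -> R, x = \sum_i c i *: v i.
Proof.
split=> [/span_predP[r [c [y [vy ->]]]]|[c ->]]; last first.
  by apply: rpred_sum => i _; apply: rpredZ; apply: mem_span; exists i.
have /choice[h hy] : forall j, exists i, v i = y j.
  by move=> j; case: (vy j) => i _ <-; exists i.
exists (fun i => \sum_(j < r | h j == i) c j).
under [RHS]eq_bigr => i _ do rewrite scaler_suml.
rewrite (exchange_big_dep xpredT) //=; apply: eq_bigr => j _.
rewrite (big_pred1 (h j)) ?hy // => i; exact: eq_sym.
Qed.

End SpanTheory.

(** * Calculus of divided powers *)

Lemma mnm_add_ind (n : nat) (S : 'X_{1..n} -> Prop) :
  S 0%MM -> (forall i b, S b -> S (U_(i) + b)%MM) -> forall b, S b.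
Proof.
move=> S0 SU b; rewrite (multinomUE_id b); elim/big_rec: _ => // i c _ Sc.
elim: (b i) => [|k IHk]; first by rewrite mulm0n add0m.
by rewrite mulmS -addmA; apply: SU.
Qed.

(** If [b + c <= m], both sides are the trinomial coefficient m! / (b! c! (m-b-c)!), and otherwise
    both vanish. It governs the product of two divided powers. *)
Lemma mul_bin_trinomial m b c :
  ('C(m, c) * 'C(m - c, b) = 'C(b + c, b) * 'C(m, b + c))%N.
Proof.
have [lt_mc|le_cm] := ltnP m c.
  by rewrite bin_small // mul0n mulnC bin_small ?mul0n // ltn_addl.
have [lt_b|le_b] := ltnP (m - c) b.
  rewrite mulnC bin_small // mul0n mulnC bin_small ?mul0n //.
  by rewrite -(subnK le_cm) ltn_add2r.
have le_bc : (b + c <= m)%N by rewrite -(subnK le_cm) leq_add2r.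
apply/eqP; rewrite -(eqn_pmul2r (fact_gt0 b)) -(eqn_pmul2r (fact_gt0 c)).
rewrite -(eqn_pmul2r (fact_gt0 (m - (b + c)))); apply/eqP.
have E1 := bin_fact le_cm; have E2 := bin_fact le_b; have E3 := bin_fact le_bc.
have E4 := bin_fact (leq_addr c b); rewrite addKn in E4.
rewrite -subnDA [(c + b)%N]addnC in E2.
move: ('C(m, c)) ('C(m - c, b)) ('C(b + c, b)) ('C(m, b + c)) E1 E2 E3 E4 => u v w x.
move: (m - (b + c))`! (b + c)`! (m - c)`! b`! c`! => f1 f2 f3 f4 f5 E1 E2 E3 E4.
transitivity (u * (f5 * (v * (f4 * f1))))%N; first by rewrite -!mulnA [(v * _)%N]mulnCA; lia.
by rewrite E2 E1 -E3 -E4; lia.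
Qed.

Section DividedPowers.
Variables (K : fieldType) (n : nat).
Local Notation P := {mpoly K[n]}.
Local Notation D := (diffops {mpoly K[n]}).

Lemma diffop_eqX (u v : D) : (forall m, dapp u 'X_[m] = dapp v 'X_[m]) -> u = v.
Proof.
move=> uv; apply: diffop_eq => f; rewrite [f]mpolyE !dapp_sum.
by apply: eq_bigr => m _; rewrite !linearZ /= uv.
Qed.

Lemma constDE c f : dapp (constD K n c) f = c *: f.
Proof. by rewrite [constD _ _ _]/(mul_diffop _) mul_diffopE mul_mpolyC. Qed.

Lemma constD_comm c (d : D) : constD K n c * d = d * constD K n c.
Proof. by apply: diffop_eq => f; rewrite !diffopME !constDE linearZ. Qed.

Lemma dpows0 : dpows K 0%MM = 1 :> D.
Proof.
apply: diffop_eqX => m; rewrite dpowsX subm0 big1 ?scale1r // => i _.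
by rewrite mnm0E bin0.
Qed.

(** On monomials this is Pascal's rule at the index [i]. The case [b i = 0] is separate because
    truncated subtraction would leave [b] unchanged there instead of giving zero. *)
Lemma dpows_var b (i : 'I_n) :
  dpows K b * mul_diffop 'X_i =
  mul_diffop 'X_i * dpows K b +
    (if b i == 0%N then 0 else dpows K (b - U_(i))%MM) :> D.
Proof.
apply: diffop_eqX => m; rewrite diffopDE !diffopME !mul_diffopE -mpolyXD !dpowsX.
rewrite (bigD1 i) //= [in X in _ = X + _](bigD1 i) //= mnmDE mnm1E eqxx add1n.
have -> : (\prod_(j < n | j != i) 'C((U_(i) + m)%MM j, b j) =
    \prod_(j < n | j != i) 'C(m j, b j))%N.
  by apply: eq_bigr => j /negPf ji; rewrite mnmDE mnm1E eq_sym ji.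
set c := (\prod_(j < n | j != i) _)%N.
rewrite -scalerAr -mpolyXD; case: eqP => [bi0|/eqP bi].
  have -> : dapp (0 : D) 'X_[m] = 0 by [].
  rewrite bi0 !bin0 addr0; congr (_ *: 'X_[_]); apply/mnmP => j.
  rewrite !(mnmDE, mnmBE, mnm1E); case: eqP => [<-|]; last by rewrite !add0n.
  by rewrite bi0 !subn0.
rewrite dpowsX [in X in _ = _ + X](bigD1 i) //=.
have -> : (\prod_(j < n | j != i) 'C(m j, (b - U_(i))%MM j) = c)%N.
  by apply: eq_bigr => j /negPf ji; rewrite mnmBE mnm1E eq_sym ji subn0.
have -> : (m - (b - U_(i)) = U_(i) + m - b)%MM.
  apply/mnmP => j; rewrite !(mnmDE, mnmBE, mnm1E); case: eqP => [<-|]; last by rewrite subn0.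
  by case: (b i) bi => // k _; rewrite subn1 add1n subSS.
rewrite mnmBE mnm1E eqxx; case bE : (b i) bi => [//|k] _; rewrite subn1 /= binS.
rewrite mulnDl natrD scalerDl; congr (_ + _).
have [lt_mk|le_km] := ltnP (m i) k.+1; first by rewrite bin_small // mul0n !scale0r.
congr (_ *: 'X_[_]); apply/mnmP => j; rewrite !(mnmDE, mnmBE, mnm1E).
by case: eqP => [<-|]; rewrite ?add0n // bE addnBA.
Qed.

Lemma dpowsM b c : dpows K b * dpows K c =
  constD K n (\prod_i 'C(b i + c i, b i))%:R * dpows K (b + c)%MM :> D.
Proof.
apply: diffop_eqX => m; rewrite !diffopME constDE !dpowsX linearZ /= dpowsX !scalerA.
rewrite -!natrM -!big_split /= addmC -submDA; congr (_%:R *: _).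
apply: eq_bigr => i _; rewrite !(mnmBE, mnmDE) [(c i + b i)%N]addnC.
by rewrite mul_bin_trinomial.
Qed.

End DividedPowers.

(** * The module of a point *)

Section PointModule.
Variables (K : closedFieldType) (p : nat) (hp : p \in [pchar K]) (n : nat).
Variable a : 'I_n -> K.
Local Notation P := {mpoly K[n]}.
Local Notation D := (diffops {mpoly K[n]}).
Local Notation m := (point_ideal a).
Local Notation U := (Umod m).
Local Notation delta := (Ubar1 m).
Local Notation mul f := (@mul_diffop K P f).
Local Notation cst c := (constD K n c).

Definition shiftvar (i : 'I_n) : P := 'X_i - (a i)%:MP.
Local Notation z := shiftvar.

Lemma mul_constE c : mul c%:MP = cst c. Proof. by []. Qed.

Lemma residue_scaleE (s : P) (q : residue m) : s *: q = residue_class m s * q :> {ideal_quot m}.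
Proof. by []. Qed.

Lemma residue_eq (f g : P) : f - g \in m -> residue_class m f = residue_class m g.
Proof. by move=> fg; apply/eqP; rewrite -Quotient.idealrBE. Qed.

Lemma scale_Utens (d d' : D) (q : residue m) : d *: Utens d' q = Utens (d * d') q.
Proof. exact: extscal_scale_tens. Qed.

Lemma Utens_bal d s (q : residue m) : Utens (d * mul s) q = Utens d (s *: q).
Proof. exact: (tens_bal (fun (d : D) f => d * mul f)). Qed.

Lemma scale_residue_class f g : f *: residue_class m g = residue_class m (f * g).
Proof. by rewrite residue_scaleE /residue_class -rmorphM. Qed.

Lemma Utens_delta d f : Utens d (residue_class m f) = (d * mul f) *: delta.
Proof. by rewrite scale_Utens mulr1 Utens_bal scale_residue_class mulr1. Qed.

Lemma Utens_deltaE d (q : residue m) : exists f, q = residue_class m f /\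
  Utens d q = (d * mul f) *: delta.
Proof.
exists (repr (q : {ideal_quot m})); rewrite -Utens_delta.
by have -> : residue_class m (repr (q : {ideal_quot m})) = q by apply: reprK.
Qed.

Lemma delta_gen (u : U) : exists d : D, u = d *: delta.
Proof.
elim/tensor_ind: u => [|_ _ [d ->] [d' ->]|d q]; first by exists 0; rewrite scale0r.
  by exists (d - d'); rewrite scalerBl.
have [f [_ E]] := Utens_deltaE d q.
by exists (d * mul f); rewrite -E.
Qed.

Lemma mul_delta f : mul f *: delta = cst f.@[a] *: delta.
Proof.
have E g : mul g *: delta = Utens 1 (residue_class m g).
  by rewrite Utens_delta mul1r.
by rewrite -mul_constE !E; congr Utens; apply: residue_eq; apply: point_ideal_meval.
Qed.

Lemma shiftvar_delta i : mul (z i) *: delta = 0.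
Proof.
by rewrite mul_delta mevalB mevalXU mevalC subrr /constD /= !rmorph0 scale0r.
Qed.

(** The universal property yields a map from U to the quotient of D by the left ideal generated by
    the [z i], sending [d *: delta] to the class of [d]. *)
Lemma delta_ann (d : D) : d *: delta = 0 -> exists u : 'I_n -> D, d = \sum_i u i * mul (z i).
Proof.
pose N := span_pred (V := (D^o : lmodType D)) (range (fun i => mul (z i))).
pose Q := {ideal_quot N}.
have Nm (e : D) f : f \in m -> e * mul f \in N.
  case/point_ideal_predP=> g ->; rewrite raddf_sum mulr_sumr; apply: rpred_sum => i _ /=.
  rewrite rmorphM mulrA; apply: (@rpredZ _ (D^o : lmodType D)).
  by apply: mem_span; exists i.
have eqN (e : D) f g : f - g \in m -> \pi_Q%qT (e * mul f) = \pi_Q%qT (e * mul g).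
  move=> fg; apply/eqP; rewrite -Quotient.idealrBE -mulrBr -rmorphB.
  exact: Nm.
pose g (e : D) (q : residue m) : Q := \pi_Q%qT (e * mul (repr (q : {ideal_quot m}))).
have gE e f : g e (residue_class m f) = \pi_Q%qT (e * mul f).
  by apply: eqN; rewrite Quotient.idealrBE /residue_class reprK.
have repE (q : residue m) : q = residue_class m (repr (q : {ideal_quot m})).
  by rewrite /residue_class reprK.
have [e e' q|e q q'|e s q|F FE] := @tensor_lift D P (fun (d : D) f => d * mul f)
   (residue m) Q g.
- by rewrite /g mulrDl raddfD.
- rewrite [q]repE [q']repE -[X in g e X]/(residue_class m _ + residue_class m _).
  by rewrite /residue_class -raddfD [LHS]gE !gE raddfD mulrDr raddfD.
- by rewrite [q]repE scale_residue_class !gE rmorphM mulrA.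
move=> d0; have : F (Utens d (residue_class m 1)) = 0.
  by rewrite Utens_delta rmorph1 mulr1 d0 raddf0.
rewrite FE gE rmorph1 mulr1 => dN.
have /eqP : \pi_Q%qT d = \pi_Q%qT 0 by rewrite dN raddf0.
rewrite -Quotient.idealrBE subr0.
by move/span_finP => [u ->]; exists u.
Qed.

End PointModule.

Section QLinear.
Variables (K : fieldType) (p : nat) (hp : p \in [pchar K]) (n : nat).

(** Since [k < p ^ k], the largest order occurring in the family can itself serve as the
    exponent. *)
Lemma qlin_family (I : finType) (u : I -> diffops {mpoly K[n]}) :
  exists e, forall i, qlin p e (u i).
Proof.
have /choice[k uk] : forall i, exists k, diffop_of_order k (diffop_val (u i)).
  by move=> i; apply/diffop_predP; case: (u i).
exists (\max_i k i) => i g f.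
apply: (diffop_of_order_lin hp (uk i) _ g f).
by rewrite (leq_ltn_trans (leq_bigmax i)) // ltn_expl // prime_gt1 // (pcharf_prime hp).
Qed.

End QLinear.

Lemma lepm_subU (n : nat) (g b : 'X_{1..n}) (i : 'I_n) : b i != 0%N ->
  (g <= b - U_(i))%MM = (U_(i) + g <= b)%MM.
Proof.
move=> bi; apply/mnm_lepP/mnm_lepP => le j; move: (le j); rewrite mnmDE mnmBE mnm1E;
  by case: eqP => [<-|_] /=; lia.
Qed.

(** * The basis of divided powers applied to delta *)

Section PointModuleBasis.
Variables (K : closedFieldType) (p : nat) (hp : p \in [pchar K]) (n : nat).
Variable a : 'I_n -> K.
Local Notation P := {mpoly K[n]}.
Local Notation D := (diffops {mpoly K[n]}).
Local Notation m := (point_ideal a).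
Local Notation U := (Umod m).
Local Notation delta := (Ubar1 m).
Local Notation mul f := (@mul_diffop K P f).
Local Notation cst c := (constD K n c).
Local Notation z := (shiftvar a).

Definition shiftmon (b : 'X_{1..n}) : P := \prod_i z i ^+ b i.

Lemma shiftmon0 : shiftmon 0%MM = 1.
Proof. by apply: big1 => i _; rewrite mnm0E expr0. Qed.

Lemma shiftmonD i b : shiftmon (U_(i) + b)%MM = z i * shiftmon b.
Proof.
rewrite /shiftmon (bigD1 i) //= [in RHS](bigD1 i) //= mulrA -exprS mnmDE mnm1E eqxx add1n.
by congr (_ * _); apply: eq_bigr => j /negPf ji; rewrite mnmDE mnm1E eq_sym ji.
Qed.

Lemma dpows_shiftvar b i :
  dpows K b * mul (z i) =
  mul (z i) * dpows K b + (if b i == 0%N then 0 else dpows K (b - U_(i))%MM) :> D.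
Proof.
have -> : mul (z i) = mul 'X_i - cst (a i) by exact: rmorphB.
rewrite mulrBr mulrBl dpows_var constD_comm.
by rewrite addrAC.
Qed.

(** Move one factor [z i] across the divided power: the term where it ends up in front vanishes at
    [a], and the commutator term is the previous case. *)
Lemma dpows_shiftmon_eval b : (dapp (dpows K b) (shiftmon b)).@[a] = 1.
Proof.
elim/mnm_add_ind: b => [|i b IHb].
  by rewrite dpows0 shiftmon0 [dapp _ _]/(1 : P) meval1.
rewrite shiftmonD -[z i * _]mul_diffopE -diffopME dpows_shiftvar diffopDE diffopME mul_diffopE.
rewrite mnmDE mnm1E eqxx /= addmC addmK mevalD mevalM mevalB mevalXU mevalC subrr mul0r add0r.
exact: IHb.
Qed.

(** A relation expressing 1 through the [z i] is applied to [f], the product of the (x_i -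
    a_i)^(q-1). The extra factor [z i] completes a q-th power, which comes out of both [u i] and T,
    so that T(f) vanishes at [a]; yet its value there is 1. *)
Lemma delta_neq0 : delta != 0.
Proof.
apply/eqP => d0; have [u uE] : exists u : 'I_n -> D, 1 = \sum_i u i * mul (z i).
  by apply: delta_ann; rewrite scale1r.
have [e ulin] := qlin_family hp u.
have := dpows_shiftmon_eval (top p n e); set f := shiftmon _.
have -> : f = \sum_i z i ^+ (p ^ e) * dapp (u i) (\prod_(j | j != i) z j ^+ (p ^ e).-1).
  rewrite -[LHS]/(dapp 1 f) uE diffop_sumE; apply: eq_bigr => i _.
  rewrite diffopME mul_diffopE -ulin; congr (dapp _ _).
  rewrite /f /shiftmon (bigD1 i) //= mulrA -exprS mnmE prednK; last first.
    by rewrite expn_gt0 prime_gt0 // (pcharf_prime hp).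
  by congr (_ * _); apply: eq_bigr => j _; rewrite mnmE.
rewrite dapp_sum raddf_sum big1 => [/eqP|i _]; first by rewrite eq_sym oner_eq0.
rewrite -/(trace K p n e) /= (trace_lin hp) mevalM rmorphXn /= mevalB mevalXU mevalC subrr.
by rewrite expr0n expn_eq0 eqn0Ngt prime_gt0 ?mul0r // (pcharf_prime hp).
Qed.

Definition Ubasis (b : 'X_{1..n}) : U := dpows K b *: delta.

Lemma scale_cst (c : K) (u : U) : c *: (u : Kspace U) = cst c *: u.
Proof. by []. Qed.

Lemma shiftvar_Ubasis i b :
  mul (z i) *: Ubasis b = if b i == 0%N then 0 else - Ubasis (b - U_(i))%MM.
Proof.
have := congr1 (fun d : D => d *: delta) (dpows_shiftvar b i).
rewrite scalerDl -!scalerA shiftvar_delta scaler0 => /eqP.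
rewrite eq_sym addr_eq0 => /eqP ->.
by case: eqP; rewrite ?scale0r ?oppr0.
Qed.

Lemma shiftmon_Ubasis g b :
  mul (shiftmon g) *: Ubasis b =
  if (g <= b)%MM then (-1) ^+ mdeg g *: Ubasis (b - g)%MM else 0.
Proof.
elim/mnm_add_ind: g b => [|i g IHg] b.
  rewrite shiftmon0 rmorph1 scale1r mdeg0 expr0 scale1r subm0.
  by have -> : (0 <= b)%MM by apply/mnm_lepP => j; rewrite mnm0E.
rewrite shiftmonD mulrC rmorphM -scalerA shiftvar_Ubasis; case: eqP => [bi0|/eqP bi].
  rewrite scaler0; case: mnm_lepP => // /(_ i).
  by rewrite mnmDE mnm1E eqxx bi0.
rewrite scalerN IHg mdegD mdeg1 exprS mulN1r.
rewrite lepm_subU //.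
by case: ifP; rewrite ?oppr0 // submDA scaleNr.
Qed.

Lemma cst_delta_eq0 c : cst c *: delta = 0 -> c = 0.
Proof.
move=> c0; apply/eqP; apply: contraT => cn0; case/eqP: delta_neq0.
by rewrite -[delta]scale1r -(rmorph1 (constD K n)) -(mulVf cn0) rmorphM -scalerA c0 scaler0.
Qed.

(* A multiplication by a monomial in the [x_i - a_i] isolates the coefficient *)
(* of a term of maximal degree.                                               *)
Lemma Ubasis_lead (I : eqType) (s : seq I) (beta : I -> 'X_{1..n}) (c : I -> K) :
  injective beta -> uniq s -> (exists2 i, i \in s & c i != 0) ->
  exists i0, [/\ i0 \in s, c i0 != 0,
    forall i, i \in s -> c i != 0 -> (mdeg (beta i) <= mdeg (beta i0))%N
    & mul (shiftmon (beta i0)) *: (\sum_(i <- s) cst (c i) *: Ubasis (beta i)) =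
      cst ((-1) ^+ mdeg (beta i0) * c i0) *: delta].
Proof.
move=> beta_inj uniq_s [i1 i1s ci1].
pose N := (\max_(i <- s) mdeg (beta i))%N.
have exd : exists d, has (fun i => (c i != 0) && (mdeg (beta i) == d)) s.
  by exists (mdeg (beta i1)); apply/hasP; exists i1; rewrite ?ci1 ?eqxx.
have [i|d /hasP[i0 i0s /andP[ci0 /eqP di0]] dmax] := ex_maxnP exd (m := N).
  by case/hasP=> j js /andP[_ /eqP <-]; apply: leq_bigmax_seq.
have lead i : i \in s -> c i != 0 -> (mdeg (beta i) <= mdeg (beta i0))%N.
  by move=> si ci; rewrite di0; apply: dmax; apply/hasP; exists i; rewrite ?ci ?eqxx.
exists i0; split=> //; rewrite scaler_sumr (bigD1_seq i0) // big_seq_cond.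
rewrite big1 => [|i /andP[si ii0]].
  rewrite [LHS]addr0 scalerA -constD_comm -scalerA shiftmon_Ubasis lepm_refl.
  have -> : (beta i0 - beta i0 = 0)%MM by apply/mnmP => j; rewrite mnmBE mnm0E subnn.
  rewrite /Ubasis dpows0 scale1r scalerA mulrC (rmorphM (constD K n)).
  by rewrite (rmorphXn (constD K n)) (rmorphN1 (constD K n)).
rewrite scalerA -constD_comm -scalerA shiftmon_Ubasis.
have [->|ci] := eqVneq (c i) 0; first by rewrite rmorph0 scale0r.
case: mnm_lepP => [le|_]; last by rewrite scaler0.
case/eqP: ii0; apply: beta_inj; apply/mnmP => j.
(* A surviving index has [beta i0 <= beta i], and the degree of [beta i0] is maximal, so the two
   exponents agree. *)
have : \sum_j (beta i j - beta i0 j)%N = 0%N.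
  apply/eqP; rewrite sumnB // -!mdegE subn_eq0; exact: lead.
move/eqP; rewrite sum_nat_eq0 => /forallP/(_ j); rewrite /= subn_eq0 => le'.
by apply/eqP; rewrite eqn_leq le le'.
Qed.

Lemma Ubasis_indep (B : set 'X_{1..n}) : lin_indep (V := Kspace U) B Ubasis.
Proof.
move=> s c uniq_s _ sum0 i si; apply/eqP; apply: contraT => ci.
have [i0 [_ ci0 _]] := @Ubasis_lead _ s id c (@inj_id _) uniq_s (ex_intro2 _ _ i si ci).
rewrite -[X in _ *: X]/(\sum_(i <- s) c i *: (Ubasis i : Kspace U)) sum0 scaler0.
move/esym/cst_delta_eq0/eqP; rewrite mulf_eq0 (negPf ci0) orbF expf_eq0.
by rewrite oppr_eq0 oner_eq0 andbF.
Qed.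

(** The degree bound is strict, to match the finite type ['X_{1..n < k}]; hence the filtration step
    [Ufilt m i] is [Uspan i.+1]. *)
Definition Uspan (k : nat) : {pred Kspace U} :=
  span_pred (range (fun b : 'X_{1..n < k} => Ubasis b : Kspace U)).
HB.instance Definition _ k := GRing.SubmodClosed.on (Uspan k).

Lemma Ubasis_Uspan k b : (mdeg b < k)%N -> (Ubasis b : Kspace U) \in Uspan k.
Proof. by move=> lt_bk; apply: mem_span; exists (BMultinom lt_bk). Qed.

Lemma UspanP k (u : U) : (u : Kspace U) \in Uspan k <->
  exists c : 'X_{1..n < k} -> K, u = \sum_b cst (c b) *: Ubasis b.
Proof. exact: span_finP. Qed.

Lemma Uspan_scale k (d : D) (S : submodClosed (Kspace U)) :
  (forall b : 'X_{1..n}, (mdeg b < k)%N -> (d *: Ubasis b : Kspace U) \in S) ->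
  forall u : U, (u : Kspace U) \in Uspan k -> (d *: u : Kspace U) \in S.
Proof.
move=> dS u /UspanP[c ->]; rewrite scaler_sumr.
apply: (@rpred_sum (Kspace U)) => b _; rewrite scalerA -constD_comm -scalerA.
by apply: (@rpredZ _ (Kspace U)); apply: dS; case: b.
Qed.

Lemma Uspan_mono k l (u : Kspace U) : (k <= l)%N -> u \in Uspan k -> u \in Uspan l.
Proof.
move=> le_kl; apply: span_subset => _ [b _ <-]; apply: Ubasis_Uspan.
by apply: leq_trans le_kl; case: b.
Qed.

(** Write each variable as [z i] plus a scalar: the first lowers the degree and the second keeps it.
    So only the divided powers in an operator can raise the degree. *)
Lemma Uspan_mul k f (u : U) : (u : Kspace U) \in Uspan k ->
  (mul f *: u : Kspace U) \in Uspan k.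
Proof.
elim/mpoly_gen_ind: f u => [c|i|f g IHf IHg|f g IHf IHg] u uk.
- exact: (@rpredZ _ (Kspace U)).
- have -> : mul 'X_i = mul (z i) + cst (a i) by rewrite rmorphB subrK.
  rewrite scalerDl; apply: (@rpredD (Kspace U)); last exact: (@rpredZ _ (Kspace U)).
  apply: (@Uspan_scale k) uk => b lt_bk; rewrite shiftvar_Ubasis.
  case: eqP => _; first exact: (@rpred0 (Kspace U)).
  rewrite (@rpredN (Kspace U)); apply: Ubasis_Uspan.
  exact: leq_ltn_trans (mdegB _ _) lt_bk.
- by rewrite rmorphD scalerDl; apply: (@rpredD (Kspace U)); [apply: IHf|apply: IHg].
- by rewrite rmorphM -scalerA; apply: IHf; apply: IHg.
Qed.

Lemma Uspan_dpows k c (u : U) : (u : Kspace U) \in Uspan k ->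
  (dpows K c *: u : Kspace U) \in Uspan (mdeg c + k).
Proof.
apply: Uspan_scale => b lt_bk; rewrite /Ubasis scalerA dpowsM -scalerA.
apply: (@rpredZ _ (Kspace U)); apply: Ubasis_Uspan.
by rewrite mdegD ltn_add2l.
Qed.

(** Expand [d] into terms f T g. On delta, g is a scalar, T gives the basis vector of index [top],
    and f does not raise degrees. *)
Lemma Uspan_exhaust (u : U) : exists k, (u : Kspace U) \in Uspan k.
Proof.
have [d ->] := delta_gen u.
have [e /(_ tt) dlin] := qlin_family hp (fun _ : unit => d).
exists (mdeg (top p n e)).+1; rewrite (qlin_expand hp dlin) scaler_suml.
apply: (@rpred_sum (Kspace U)) => b _; rewrite -!scalerA; apply: Uspan_mul.
rewrite mul_delta scalerA -constD_comm -scalerA.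
by apply: (@rpredZ _ (Kspace U)); apply: Ubasis_Uspan.
Qed.

(** The first two conclusions bring any nonzero vector back to delta, which gives simplicity. The
    third handles a trivial monomial, where [u] has no term of positive degree; it is what
    determines the vectors killed by all [z i]. *)
Lemma U_lead (u : U) : u != 0 -> exists b c,
  [/\ c != 0, mul (shiftmon b) *: u = cst c *: delta
    & b = 0%MM -> exists c', u = cst c' *: delta].
Proof.
have [k /UspanP[c ->]] := Uspan_exhaust u.
have [allc0|] := pselect (forall b, c b = 0).
  by rewrite big1 ?eqxx // => b _; rewrite allc0 rmorph0 scale0r.
case/existsNP=> b1 /eqP cb1 _.
have [b0 [_ cb0 bmax E]] := @Ubasis_lead _ (index_enum _) (@bmnm n k) c val_inj
  (index_enum_uniq _) (ex_intro2 _ _ b1 (mem_index_enum b1) cb1).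
exists (bmnm b0), ((-1) ^+ mdeg b0 * c b0); split=> //.
  by rewrite mulf_neq0 // expf_neq0 // oppr_eq0 oner_eq0.
move=> b00; exists (c b0); rewrite (bigD1 b0) //= /Ubasis b00 dpows0 scale1r.
rewrite big1 ?addr0 // => b bb0; have [->|cb] := eqVneq (c b) 0.
  by rewrite rmorph0 scale0r.
case/eqP: bb0; apply: val_inj; rewrite /= b00; apply/eqP.
by have := bmax b (mem_index_enum b) cb; rewrite b00 mdeg0 leqn0 mdeg_eq0.
Qed.

End PointModuleBasis.

Arguments Uspan {K n} a k.

(** * Isomorphism classes and Schur's lemma *)

Lemma inj_surj_bij (X Y : Type) (f : X -> Y) :
  injective f -> (forall y, exists x, f x = y) -> bijective f.
Proof.
by move=> finj /choice[g gK]; exists g => // x; apply: finj; rewrite gK.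
Qed.

Lemma zmod_morphismB (V W : zmodType) (f : V -> W) :
  (forall x y, f (x + y) = f x + f y) -> forall x y, f (x - y) = f x - f y.
Proof. by move=> fD x y; rewrite -{2}(subrK y x) fD addrK. Qed.

Section ModuleTheory.
Variable R : pzRingType.
Implicit Types M N : lmodType R.

Lemma isomorphic_sym M N : isomorphic M N -> isomorphic N M.
Proof.
case=> f [g fK gK].
have glin : linear g.
  by move=> c x y; apply: (can_inj fK); rewrite linearP !gK.
pose gM := GRing.isLinear.Build R N M *:%R g glin.
pose gL : {linear N -> M} := HB.pack g gM.
by exists gL; exists f.
Qed.

Lemma isomorphic_trans M N L : isomorphic M N -> isomorphic N L -> isomorphic M L.
Proof.
by case=> f fB [g gB]; exists (g \o f : {linear M -> L}); exact: bij_comp.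
Qed.

Lemma isoclass_eq M N : isomorphic M N -> isoclass M = isoclass N.
Proof.
move=> MN; apply/funext => L; apply/propext; split; last exact: isomorphic_trans.
by apply: isomorphic_trans; exact: isomorphic_sym.
Qed.

Lemma isoclass_inj M N : isoclass M = isoclass N -> isomorphic M N.
Proof.
by move=> E; rewrite -/(isoclass M N) E; exists (idfun : {linear N -> N}); exists idfun.
Qed.

(** Schur's lemma: the kernel and the image are submodules of simple modules. *)
Lemma simple_bijective M N (f : {linear M -> N}) :
  simple_module M -> simple_module N -> (exists x, f x != 0) -> bijective f.
Proof.
move=> [_ sM] [_ sN] [x0 fx0].
pose kpred : {pred M} := [pred x | f x == 0].
have kclosed : submod_closed kpred.
  split=> [|c x y /eqP fx /eqP fy]; first by rewrite inE linear0.
  by rewrite inE linearP fx fy scaler0 addr0.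
pose k : submodClosed M := HB.pack kpred (GRing.isSubmodClosed.Build R M kpred kclosed).
pose ipred : {pred N} := [pred y | `[< exists x, f x = y >]].
have iclosed : submod_closed ipred.
  split=> [|c _ _ /asboolP[x <-] /asboolP[y <-]]; apply/asboolP.
    by exists 0; rewrite linear0.
  by exists (c *: x + y); rewrite linearP.
pose im : submodClosed N := HB.pack ipred (GRing.isSubmodClosed.Build R N ipred iclosed).
apply: inj_surj_bij => [x y fxy|y].
  have [k0|kT] := sM k; last by have := kT x0; rewrite inE (negPf fx0).
  apply/eqP; rewrite -subr_eq0; apply/eqP/k0.
  by rewrite inE linearB fxy subrr.
have [i0|iT] := sN im; last exact/asboolP/iT.
case/eqP: fx0; apply: i0.
by apply/asboolP; exists x0.
Qed.

End ModuleTheory.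

(** * Simplicity, endomorphisms, associated primes and presentation of U(a) *)

Section PointModuleStructure.
Variables (K : closedFieldType) (p : nat) (hp : p \in [pchar K]) (n : nat).
Variable a : 'I_n -> K.
Local Notation P := {mpoly K[n]}.
Local Notation D := (diffops {mpoly K[n]}).
Local Notation m := (point_ideal a).
Local Notation U := (Umod m).
Local Notation delta := (Ubar1 m).
Local Notation mul f := (@mul_diffop K P f).
Local Notation cst c := (constD K n c).
Local Notation z := (shiftvar a).

Lemma U_simple : simple_module U.
Proof.
split=> [|N]; first by exists delta; apply: (delta_neq0 hp).
have [[u Nu u0]|N0] := pselect (exists2 u, u \in N & u != 0); [right|left]; last first.
  by move=> u Nu; apply: contrapT => /eqP u0; apply: N0; exists u.
have [b [c [c0 E _]]] := U_lead hp u0.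
have Nd : delta \in N.
  have -> : delta = cst c^-1 *: (mul (shiftmon a b) *: u).
    by rewrite E scalerA -(rmorphM (constD K n)) mulVf // (rmorph1 (constD K n)) scale1r.
  by rewrite !rpredZ.
by move=> v; have [d ->] := delta_gen v; rewrite rpredZ.
Qed.

(** A nontrivial monomial in [U_lead] would contain some [z i] and kill [u], whereas its product
    with [u] is a nonzero multiple of delta. *)
Lemma U_socle (u : U) : (forall i, mul (z i) *: u = 0) -> exists c, u = cst c *: delta.
Proof.
move=> zu; have [->|u0] := eqVneq u 0; first by exists 0; rewrite (rmorph0 (constD K n)) scale0r.
have [b [c [c0 E b0]]] := U_lead hp u0.
have [b00|/eqP] := pselect (b = 0%MM); first exact: b0.
rewrite -mdeg_eq0 mdegE sum_nat_eq0 negb_forall => /existsP[i /= bi].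
move: E; have -> : b = (U_(i) + (b - U_(i)))%MM by rewrite addmC submK // lep1mP.
rewrite shiftmonD mulrC rmorphM -scalerA zu scaler0 => /esym/(cst_delta_eq0 hp) cE.
by rewrite cE eqxx in c0.
Qed.

(** An endomorphism is determined by the image of delta. That image is killed by every [z i], hence
    is a scalar multiple of delta; and scalars are central in D. *)
Lemma U_endo : exists phi : {rmorphism K -> endo U},
  bijective phi /\ forall c u, phi c u = cst c *: u.
Proof.
have lin c : linear (fun u : U => cst c *: u).
  by move=> d u v; rewrite scalerDr !scalerA constD_comm.
pose phi0 c : endo U := HB.pack_for {linear U -> U} (fun u : U => cst c *: u)
   (GRing.isLinear.Build D U U *:%R _ (lin c)).
have phiE c u : phi0 c u = cst c *: u by [].
have phiB : zmod_morphism phi0.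
  by move=> c d; apply: endoP => u; rewrite endoBE !phiE (rmorphB (constD K n)) scalerBl.
have phiM : monoid_morphism phi0.
  split=> [|c d]; apply: endoP => u; first by rewrite endo1E phiE (rmorph1 (constD K n)) scale1r.
  by rewrite endoME !phiE (rmorphM (constD K n)) scalerA.
pose phi : {rmorphism K -> endo U} := HB.pack phi0
  (GRing.isZmodMorphism.Build K (endo U) phi0 phiB)
  (GRing.isMonoidMorphism.Build K (endo U) phi0 phiM).
exists phi; split=> //; apply: inj_surj_bij => [c d cd|f].
  apply/eqP; rewrite -subr_eq0; apply/eqP/(cst_delta_eq0 (a := a) hp).
  have := congr1 (fun f : endo U => f delta) cd; rewrite [LHS]phiE [RHS]phiE.
  by rewrite (rmorphB (constD K n)) scalerBl => ->; rewrite subrr.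
have [i|c fd] := @U_socle (f delta).
  by rewrite -linearZZ shiftvar_delta linear0.
exists c; apply: endoP => u; have [d ->] := delta_gen u.
by rewrite [LHS]phiE linearZZ fd !scalerA constD_comm.
Qed.

Lemma U_ass : assP U = [set m].
Proof.
apply/seteqP; split=> I /=; last first.
  move=> ->; split.
    move=> f g; rewrite !mem_point_ideal mevalM mulf_eq0 => /orP[] ->; rewrite ?orbT //.
  exists delta => f; rewrite -[_ *: _]/(mul f *: delta) mul_delta mem_point_ideal.
  split=> [/eqP ->|/(cst_delta_eq0 hp) ->//].
  by rewrite (rmorph0 (constD K n)) scale0r.
case=> Ip [u uI].
have Iu f : f \in I <-> mul f *: (u : U) = 0 by exact: uI.
have u0 : (u : U) != 0.
  by apply/eqP => u0; have := idealr1 I; rewrite (_ : 1 \in I) //; apply/Iu; rewrite u0 scaler0.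
have mI : {subset m <= I}.
  have zI i : z i \in I.
    have [k uk] := Uspan_exhaust hp (u : U).
    (* All degrees in [u] are below [k], so the k-th power of [z i] kills [u]; primality of [I] then
       extracts [z i] itself. *)
    have : shiftmon a (U_(i) *+ k)%MM \in I.
      apply/Iu; have /UspanP[c ->] := uk; rewrite scaler_sumr big1 // => b _.
      rewrite scalerA -constD_comm -scalerA shiftmon_Ubasis.
      case: mnm_lepP => [/(_ i)|_]; last by rewrite scaler0.
      rewrite mulmnE mnm1E eqxx mul1n => le_kb.
      have := leq_trans (valP b) le_kb; rewrite ltnNge /= mdegE (bigD1 i) //=.
      by rewrite leq_addr.
    elim: k {uk} => [|k IHk]; first by rewrite mulm0n shiftmon0 idealr1.
    by rewrite mulmS shiftmonD => /Ip/orP[|/IHk].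
  move=> _ /point_ideal_predP[g ->]; apply: rpred_sum => i _.
  exact/idealMr/zI.
exact: point_ideal_maximal.
Qed.

Lemma U_fp : finitely_presented U.
Proof.
pose f0 (w : 'rV[D]_n) : 'rV[D]_1 := \row_j \sum_i w 0 i * mul (z i).
have f0lin : linear f0.
  move=> c u v; apply/rowP => j; rewrite !mxE mulr_sumr -big_split.
  by apply: eq_bigr => i _; rewrite !mxE mulrDl mulrA.
pose g0 (v : 'rV[D]_1) : U := v 0 0 *: delta.
have g0lin : linear g0.
  by move=> c u v; rewrite /g0 !mxE scalerDl scalerA.
exists 1%N, n, (HB.pack_for {linear 'rV[D]_n -> 'rV[D]_1} f0 (GRing.isLinear.Build D _ _ *:%R f0 f0lin)),
  (HB.pack_for {linear 'rV[D]_1 -> U} g0 (GRing.isLinear.Build D _ _ *:%R g0 g0lin)).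
split=> [u|v /=].
  by have [d ->] := delta_gen u; exists (\row_j d); rewrite /= /g0 mxE.
split=> [/delta_ann[w wE]|[w ->]].
  exists (\row_i w i); apply/rowP => j; rewrite mxE ord1 wE.
  by apply: eq_bigr => i _; rewrite mxE.
rewrite /g0 mxE scaler_suml big1 // => i _.
by rewrite -scalerA shiftvar_delta scaler0.
Qed.

Lemma Ubasis_free k (c : 'X_{1..n < k} -> K) :
  \sum_b cst (c b) *: Ubasis a b = 0 -> forall b, c b = 0.
Proof.
move=> sum0 b1; apply/eqP; apply: contraT => cb1.
have [b0 [_ cb0 _]] := @Ubasis_lead _ _ a _ (index_enum _) (@bmnm n k) c val_inj
  (index_enum_uniq _) (ex_intro2 _ _ b1 (mem_index_enum b1) cb1).
rewrite sum0 scaler0 => /esym/(cst_delta_eq0 hp)/eqP.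
by rewrite mulf_eq0 (negPf cb0) orbF expf_eq0 oppr_eq0 oner_eq0 andbF.
Qed.

Lemma Lambda_val_sum (l : Lambda K n) : exists k (c : 'X_{1..n < k} -> K),
  Lambda_diffop l = \sum_b cst (c b) * dpows K b.
Proof.
case: l => l /= /span_predP[r [c [x [Xx lE]]]].
have /choice[b bx] : forall j, exists b, dpows K b = x j.
  by move=> j; case: (Xx j) => b _ <-; exists b.
exists (\max_j mdeg (b j)).+1.
suff : l \in span_pred (range (fun b : 'X_{1..n < (\max_j mdeg (b j)).+1} =>
    dpows K b : Kspace D^o)) by case/span_finP => d ->; exists d.
rewrite lE; apply: rpred_sum => j _; apply: rpredZ.
have lt_b : (mdeg (b j) < (\max_j mdeg (b j)).+1)%N.
  by rewrite ltnS (leq_bigmax (F := fun j => mdeg (b j))).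
by apply: mem_span; exists (BMultinom lt_b) => //=; exact: bx.
Qed.

Lemma Lambda_sum k (c : 'X_{1..n < k} -> K) :
  exists l : Lambda K n, Lambda_diffop l = \sum_b cst (c b) * dpows K b.
Proof.
have lP : (\sum_b c b *: (dpows K (bmnm b) : Kspace D^o)) \in @Lambda_pred K n.
  by apply: rpred_sum => b _; apply: rpredZ; apply: mem_span; exists (bmnm b).
by exists (LambdaOp lP).
Qed.

Lemma U_Lambda (u : U) : exists l : Lambda K n, u = Lambda_diffop l *: delta.
Proof.
have [k /UspanP[c ->]] := Uspan_exhaust hp u.
have [l lE] := Lambda_sum c; exists l; rewrite lE scaler_suml.
by apply: eq_bigr => b _; rewrite scalerA.
Qed.

Lemma Lambda_delta_inj (l l' : Lambda K n) :
  Lambda_diffop l *: delta = Lambda_diffop l' *: delta -> l = l'.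
Proof.
move=> ll'; apply/eqP; rewrite -subr_eq0; apply/eqP; apply: val_inj => /=.
have [k [c cE]] := Lambda_val_sum (l - l').
rewrite -[LHS]/(Lambda_diffop (l - l')) cE big1 ?raddf0 // => b _.
rewrite (@Ubasis_free _ c) ?(rmorph0 (constD K n)) ?mul0r //.
have : Lambda_diffop (l - l') *: delta = 0.
  rewrite (_ : Lambda_diffop (l - l') = Lambda_diffop l - Lambda_diffop l') //.
  by rewrite scalerBl ll' subrr.
rewrite cE scaler_suml => E; rewrite -[RHS]E; apply: eq_bigr => b' _.
by rewrite scalerA.
Qed.

Lemma Utens_delta1 (d : D) : Utens d (residue_class m 1) = d *: delta.
Proof. by rewrite Utens_delta rmorph1 mulr1. Qed.

Lemma UtensDl (d d' : D) (q : residue m) : Utens (d + d') q = Utens d q + Utens d' q.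
Proof. exact: (tensDl (fun (d : D) f => d * mul f)). Qed.

Lemma UtensDr (d : D) (q q' : residue m) : Utens d (q + q') = Utens d q + Utens d q'.
Proof. exact: (tensDr (fun (d : D) f => d * mul f)). Qed.

Lemma LambdaTensDl (l l' : Lambda K n) (q : residue m) :
  LambdaTens (l + l') q = LambdaTens l q + LambdaTens l' q.
Proof. exact: (tensDl (fun (l : Lambda K n) (c : K) => c *: l)). Qed.

Lemma LambdaTens_bal (l : Lambda K n) c f :
  LambdaTens (c *: l) (residue_class m f) = LambdaTens l (residue_class m (c%:MP * f)).
Proof.
rewrite -scale_residue_class.
exact: (tens_bal (fun (l : Lambda K n) (c : K) => c *: l)).
Qed.

(** Residue classes are represented by constants, so every tensor has the form l (x) 1, and the
    claim becomes bijectivity of [l] acting on delta. *)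
Lemma U_LambdaTensor : exists f : {additive LambdaTensor m -> U},
  bijective f /\
  forall (l : Lambda K n) (q : residue m), f (LambdaTens l q) = Utens (Lambda_diffop l) q.
Proof.
have [l l' q|l q q'|l c q|f fE] := @tensor_lift (Lambda K n) K
   (fun (l : Lambda K n) (c : K) => c *: l) (restr (constP K n) (residue m)) U
   (fun l q => Utens (Lambda_diffop l) (q : residue m)).
- exact: (UtensDl (Lambda_diffop l) (Lambda_diffop l') q).
- exact: (UtensDr (Lambda_diffop l) q q').
- rewrite -[X in _ = Utens _ X]/(constP K n c *: (q : residue m)) -Utens_bal.
  exact: (congr1 (fun d => Utens d (q : residue m)) (constD_comm c (Lambda_diffop l))).
exists f; split=> //.
have tens1 (x : LambdaTensor m) : exists l, x = LambdaTens l (residue_class m 1).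
  elim/tensor_ind: x => [|_ _ [l ->] [l' ->]|l q].
  - exists 0; have := LambdaTensDl 0 0 (residue_class m 1).
    by rewrite addr0 => /eqP; rewrite -subr_eq subrr => /eqP.
  - exists (l - l').
    exact: esym (zmod_morphismB (fun l l' => LambdaTensDl l l' (residue_class m 1)) l l').
  - have [g [qE _]] := Utens_deltaE 1 (q : residue m).
    exists (g.@[a] *: l); rewrite LambdaTens_bal mulr1.
    have -> : residue_class m (g.@[a])%:MP = residue_class m g.
      by apply/esym/residue_eq/point_ideal_meval.
    exact: (congr1 (fun q => LambdaTens l q) qE).
have f1 l : f (LambdaTens l (residue_class m 1)) = Lambda_diffop l *: delta.
  have E1 : f (LambdaTens l (residue_class m 1)) = Utens (Lambda_diffop l) (residue_class m 1) :=
    fE l (residue_class m 1).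
  exact: etrans E1 (Utens_delta1 _).
apply: inj_surj_bij => [x y|u].
  have [l ->] := tens1 x; have [l' ->] := tens1 y.
  move=> E; have /Lambda_delta_inj ll' := etrans (esym (f1 l)) (etrans E (f1 l')).
  exact: (congr1 (fun l => LambdaTens l (residue_class m 1)) ll').
have [l ul] := U_Lambda u; exists (LambdaTens l (residue_class m 1)).
exact: etrans (f1 l) (esym ul).
Qed.

End PointModuleStructure.

(** * The canonical filtration on U(a) *)

Section PointModuleFiltration.
Variables (K : closedFieldType) (p : nat) (hp : p \in [pchar K]) (n : nat).
Variable a : 'I_n -> K.
Local Notation P := {mpoly K[n]}.
Local Notation D := (diffops {mpoly K[n]}).
Local Notation m := (point_ideal a).
Local Notation U := (Umod m).
Local Notation delta := (Ubar1 m).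
Local Notation mul f := (@mul_diffop K P f).
Local Notation cst c := (constD K n c).
Local Notation z := (shiftvar a).

Lemma Uspan_bounded i :
  span_pred (Ubasis a @` [set b : 'X_{1..n} | (mdeg b <= i)%N] : set (Kspace U)) =i Uspan a i.+1.
Proof.
move=> u; apply/idP/idP; apply: span_subset => _ [b bi <-].
  exact: Ubasis_Uspan.
by apply: mem_span; exists (bmnm b) => //=; case: b {bi}.
Qed.

Lemma Ufilt_Uspan i (u : U) : Ufilt m i u <-> (u : Kspace U) \in Uspan a i.+1.
Proof.
split=> [[d [r [c [x [Xx ->]]]] <-]|].
  rewrite scaler_suml; apply: (@rpred_sum (Kspace U)) => j _.
  rewrite -scalerA; apply: (@rpredZ _ (Kspace U)).
  have [e [b [le_i ->]]] := Xx j; rewrite -scalerA; apply: Uspan_mul.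
  by apply: Ubasis_Uspan; rewrite ltnS (leq_trans _ le_i) ?leq_addl.
case/UspanP => c ->; exists (\sum_b cst (c b) * dpows K (bmnm b)).
  apply/(span_predP (V := Kspace D^o)); apply: (@rpred_sum (Kspace D^o)) => b _.
  apply: (@rpredZ _ (Kspace D^o)); apply: mem_span; exists 0%MM, (bmnm b); split.
    by rewrite mdeg0; case: b.
  by rewrite /xmon mpolyX0 rmorph1 mul1r.
by rewrite scaler_suml; apply: eq_bigr => b _; rewrite scalerA.
Qed.

Lemma U_basis_on i :
  basis_on (V := Kspace U) [set b : 'X_{1..n} | (mdeg b <= i)%N]
    (fun b => dpows K b *: delta) (Ufilt m i).
Proof.
split; first exact: (Ubasis_indep hp).
apply/seteqP; split=> u.
  by move/Ufilt_Uspan; rewrite -Uspan_bounded => /span_predP.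
by move/span_predP; rewrite Uspan_bounded => /Ufilt_Uspan.
Qed.

End PointModuleFiltration.

(** * Finitely presented simple modules *)

Section FactorThrough.
Variables (R : pzRingType) (L M N : lmodType R).

Lemma linear_factor (g : {linear L -> M}) (h : {linear L -> N}) :
  (forall x, exists v, g v = x) -> (forall v, g v = 0 -> h v = 0) ->
  exists k : {linear M -> N}, forall v, k (g v) = h v.
Proof.
move=> /choice[s gs] ker.
have E v v' : g v = g v' -> h v = h v'.
  by move=> gv; apply/eqP; rewrite -subr_eq0 -linearB; apply/eqP/ker; rewrite linearB gv subrr.
have klin : linear (h \o s).
  by move=> c x y /=; rewrite -linearP; apply: E; rewrite linearP !gs.
exists (HB.pack_for {linear M -> N} (h \o s) (GRing.isLinear.Build R M N *:%R _ klin)) => v /=.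
by apply: E; rewrite gs.
Qed.

End FactorThrough.

Lemma row_full_kernel (F : fieldType) (s r : nat) (E : 'M[F]_(s, r)) : ~~ row_full E ->
  exists w : 'cV_r, E *m w = 0 /\ w != 0.
Proof.
move=> nfull; have [k kE] : exists k, col k (cokermx E) != 0.
  apply/existsP; apply: contraR nfull; rewrite negb_exists => /forallP coker0.
  have c0 : cokermx E = 0.
    by apply/matrixP => i j; have /eqP/colP/(_ i) := negbNE (coker0 j); rewrite !mxE.
  have := mxrank_coker E; rewrite c0 mxrank0 /row_full => /esym/eqP.
  by rewrite subn_eq0 => le_r; rewrite eqn_leq le_r rank_leq_col.
by exists (col k (cokermx E)); split=> //; rewrite colE mulmxA mulmx_coker mul0mx.
Qed.

Section QLinearClosure.
Variables (K : fieldType) (p : nat) (hp : p \in [pchar K]) (n e : nat).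
Local Notation P := {mpoly K[n]}.
Local Notation D := (diffops {mpoly K[n]}).
Local Notation mul f := (@mul_diffop K P f).
Local Notation T := (trace K p n e).

Lemma qlin_mul (f : P) : qlin p e (mul f).
Proof. by move=> g h; rewrite !mul_diffopE mulrCA. Qed.

Lemma qlinM (u v : D) : qlin p e u -> qlin p e v -> qlin p e (u * v).
Proof. by move=> ul vl g h; rewrite !diffopME vl ul. Qed.

Lemma trace_qlin : qlin p e T. Proof. exact: trace_lin. Qed.

Lemma qlin_frob_comm (u : D) h : qlin p e u -> u * mul (frob K p n e h) = mul (frob K p n e h) * u.
Proof.
by move=> ul; apply: diffop_eq => f; rewrite !diffopME !mul_diffopE qlin_frob.
Qed.

Lemma qlin_mul_trace (u : D) f : qlin p e u -> u * (mul f * T) = mul (dapp u f) * T.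
Proof.
move=> ul; rewrite mulrA (qlin_trace hp) ?diffopME ?mul_diffopE ?mulr1 //.
exact/qlinM/qlin_mul.
Qed.

Lemma qlin_eq (u v : D) : qlin p e u -> qlin p e v ->
  (forall b : box p n e, dapp u 'X_[boxm b] = dapp v 'X_[boxm b]) -> u = v.
Proof.
move=> ul vl uv; rewrite (qlin_expand hp ul) (qlin_expand hp vl).
by apply: eq_bigr => b _; rewrite uv.
Qed.

Lemma qlin_sum (I : Type) (r : seq I) (S : pred I) (u : I -> D) :
  (forall i, qlin p e (u i)) -> qlin p e (\sum_(i <- r | S i) u i).
Proof.
move=> ul f g; rewrite !diffop_sumE mulr_sumr; apply: eq_bigr => i _; exact: ul.
Qed.

End QLinearClosure.

Section FinitelyPresented.
Variables (K : closedFieldType) (p : nat) (hp : p \in [pchar K]) (n : nat).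
Local Notation P := {mpoly K[n]}.
Local Notation D := (diffops {mpoly K[n]}).
Local Notation mul f := (@mul_diffop K P f).
Local Notation cst c := (constD K n c).

(* All the entries of [B] are linear over the p^e-th powers, so [B] amounts   *)
(* to a matrix [E] of polynomials. By the Nullstellensatz, either [E] is left *)
(* invertible or it degenerates at some point.                                *)
Lemma diffop_matrix_alternative (s r : nat) (B : 'I_s -> 'I_r -> D) :
  (exists X : 'I_r -> 'I_s -> D, forall j j', \sum_i X j i * B i j' = (j == j')%:R) \/
  exists (a : 'I_n -> K) (v : 'I_r -> Umod (point_ideal a)),
    (forall i, \sum_j B i j *: v j = 0) /\ exists j, v j != 0.
Proof.
have [e Blin] := qlin_family hp (fun ij : 'I_s * 'I_r => B ij.1 ij.2).
have {}Blin i j : qlin p e (B i j) := Blin (i, j).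
pose bx := box p n e; pose T := trace K p n e.
pose F := frob K p n e.
(* [F (E0 ((i, c), (j, b)))] is the coordinate along ['X_[boxm c]] of [B i j] applied to
   ['X_[boxm b]]. *)
have /choice[E0 E0E] : forall x : ('I_s * bx) * ('I_r * bx), exists h,
    dapp T ('X_[cobox x.1.2] * dapp (B x.1.1 x.2.1) 'X_[boxm x.2.2]) = F h.
  by move=> x; apply: (trace_frob hp).
pose E : 'M[P]_(#|{: 'I_s * bx}|, #|{: 'I_r * bx}|) :=
  \matrix_(k, l) E0 (enum_val k, enum_val l).
have [fullE|] := pselect (forall b : 'I_n -> K, row_full (map_mx (meval b) E)).
  have [C CE] := left_inverse_of_points fullE; left.
  (* The matrix [C] read back as operators: [T * mul 'X_[cobox c]] extracts a coordinate, the entry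
     of [C] multiplies it, and ['X_[boxm b]] puts it in place. *)
  pose X j i : D := \sum_(b : bx) \sum_(c : bx)
    mul 'X_[boxm b] * (mul (F (C (enum_rank (j, b)) (enum_rank (i, c)))) * (T * mul 'X_[cobox c])).
  exists X => j j'; apply: (qlin_eq hp) => [||b'].
  - apply: qlin_sum => i; apply: qlinM (Blin _ _); do 2![apply: qlin_sum => ?].
    apply: qlinM; first exact: qlin_mul.
    apply: qlinM; first exact: qlin_mul.
    apply: qlinM; last exact: qlin_mul.
    exact: trace_qlin.
  - case: (j == j') => f g; first by [].
    by rewrite mulr0.
  have -> : dapp (\sum_i X j i * B i j') 'X_[boxm b'] =
      \sum_(b : bx) 'X_[boxm b] * F ((C *m E) (enum_rank (j, b)) (enum_rank (j', b'))).
    rewrite diffop_sumE.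
    under eq_bigr => i _.
      rewrite diffopME diffop_sumE.
      under eq_bigr => b _.
        rewrite diffop_sumE.
        under eq_bigr => c _.
          rewrite !diffopME !mul_diffopE.
          rewrite (E0E ((i, c), (j', b'))) -rmorphM.
          over.
        over.
      over.
    rewrite exchange_big; apply: eq_bigr => b _ /=.
    rewrite mxE raddf_sum mulr_sumr (reindex enum_rank) /=; last first.
      by apply: onW_bij; exact: enum_rank_bij.
    rewrite pair_bigA; apply: eq_bigr => -[i c] _ /=.
    by rewrite mxE !enum_rankK.
  rewrite CE (bigD1 b') //= big1 ?addr0 => [|b bb']; last first.
    rewrite mxE (inj_eq enum_rank_inj) xpair_eqE (negPf bb') andbF.
    by rewrite rmorph0 mulr0.
  rewrite mxE (inj_eq enum_rank_inj) xpair_eqE eqxx andbT.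
  by case: (j == j'); rewrite ?rmorph1 ?rmorph0 ?mulr1 ?mulr0.
move/existsNP=> [b /negP/row_full_kernel[w [Ew w0]]]; right.
(* [F h] takes at [a] the value of [h] at the q-th powers of the [a i], so a degeneracy at [b] is
   seen in the module of a q-th root of [b]. *)
have /choice[a ab] : forall i, exists c, c ^+ (p ^ e) = b i.
  move=> i; have q0 : (0 < p ^ e)%N by rewrite expn_gt0 prime_gt0 // (pcharf_prime hp).
  have /closed_rootP[c] : size ('X^(p ^ e) - (b i)%:P) != 1%N.
    by rewrite size_XnsubC // eqSS eqn0Ngt q0.
  by rewrite rootE !hornerE subr_eq0 => /eqP; exists c.
have aq : (fun i => a i ^+ (p ^ e)) = b by apply/funext.
have [[j0 b0] wjb] : exists x : 'I_r * bx, w (enum_rank x) 0 != 0.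
  have [k wk] : exists k, w k 0 != 0.
    apply/existsP; apply: contraR w0; rewrite negb_exists => /forallP wk.
    by apply/eqP/colP => k; rewrite mxE; apply/eqP/negPn.
  by exists (enum_val k); rewrite enum_valK.
pose W j : P := \sum_(b : bx) w (enum_rank (j, b)) 0 *: 'X_[boxm b].
(* On [mul f *: d], an operator linear over q-th powers acts through its action on [f], and [F h]
   acts on [d] by the scalar [h.@[b]]. Polynomials times [d] thus behave like column vectors
   specialised at [b], with [W] playing the role of [w]. *)
pose d := T *: Ubar1 (point_ideal a).
have dlin u f : qlin p e u -> u *: (mul f *: d) = mul (dapp u f) *: d.
  by move=> ul; rewrite /d !scalerA -mulrA (qlin_mul_trace hp).
have dfrob h : mul (F h) *: d = cst h.@[b] *: d.
  rewrite /d scalerA -(qlin_frob_comm _ (trace_qlin hp e)) -scalerA mul_delta.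
  by rewrite meval_frob aq scalerA -constD_comm -scalerA.
have d0 : d != 0.
  apply/eqP => d0; have := @Ubasis_indep _ _ hp n a setT [:: top p n e] (fun=> 1) isT.
  move/(_ (fun _ _ => Logic.I)); rewrite big_seq1 scale1r => /(_ d0 _ (mem_head _ _))/eqP.
  by rewrite oner_eq0.
exists a, (fun j => mul (W j) *: d); split=> [i|].
  under eq_bigr => j _ do rewrite dlin //.
  rewrite -scaler_suml -raddf_sum /=.
  set G := \sum_j _; rewrite [G](trace_expand hp e) raddf_sum scaler_suml big1 // => c _ /=.
  (* The coordinate of [G] along ['X_[boxm c]] specialises at [b] to an entry of E(b) w, which is
     zero. *)
  suff [h [-> hb]] : exists h, dapp T ('X_[cobox c] * G) = F h /\ h.@[b] = 0.
    by rewrite mulrC rmorphM -scalerA dfrob hb (rmorph0 (constD K n)) scale0r scaler0.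
  exists (\sum_(x : 'I_r * bx) w (enum_rank x) 0 *: E0 ((i, c), x)); split.
    transitivity (\sum_j \sum_b1 F (w (enum_rank (j, b1)) 0 *: E0 ((i, c), (j, b1)))); last first.
      by rewrite pair_bigA raddf_sum; apply: eq_bigr => -[].
    rewrite /G mulr_sumr dapp_sum.
    apply: eq_bigr => j _; rewrite /W dapp_sum mulr_sumr dapp_sum; apply: eq_bigr => b1 _.
    rewrite linearZZ -scalerAr linearZZ (E0E ((i, c), (j, b1))).
    by rewrite -!mul_mpolyC rmorphM /= frobC.
  have := congr1 (fun A : 'cV_ _ => A (enum_rank (i, c)) 0) Ew; rewrite !mxE => sum0.
  rewrite raddf_sum /= -[RHS]sum0 [RHS](reindex enum_rank) /=; last first.
    by apply: onW_bij; exact: enum_rank_bij.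
  by apply: eq_bigr => x _; rewrite mevalZ !mxE !enum_rankK mulrC.
(* [T * mul 'X_[cobox b0]] extracts from [W j0] the coefficient [w (enum_rank (j0, b0)) 0], so it
   sends the vector of index [j0] to a nonzero multiple of [d]. *)
exists j0; apply/eqP => v0; have := dlin (T * mul 'X_[cobox b0]) (W j0) (qlinM (trace_qlin hp e) (@qlin_mul _ p n e _)).
rewrite v0 scaler0 => /esym.
rewrite diffopME mul_diffopE /W mulr_sumr dapp_sum (bigD1 b0) //= big1 => [|c cb0].
  rewrite -scalerAr linearZZ (trace_box hp) eqxx addr0 alg_mpolyC mul_constE => /eqP.
  apply/negP; apply: contra d0 => /eqP E1.
  apply/eqP; rewrite -[d]scale1r -(rmorph1 (constD K n)) -(mulVf wjb) (rmorphM (constD K n)).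
  by rewrite -scalerA E1 scaler0.
by rewrite -scalerAr linearZZ (trace_box hp) eq_sym (negPf cb0) scaler0.
Qed.

Lemma simple_fp_point (M : lmodType D) : simple_module M -> finitely_presented M ->
  exists a, isomorphic (Umod (point_ideal a)) M.
Proof.
move=> sM [r [s [f [g [gsurj gker]]]]].
pose B i j : D := f (delta_mx 0 i) 0 j.
have fE w j : f w 0 j = \sum_i w 0 i * B i j.
  rewrite {1}[w]row_sum_delta linear_sum summxE; apply: eq_bigr => i _.
  by rewrite linearZZ mxE.
have [[X XB]|[a [v [Bv [j0 vj0]]]]] := diffop_matrix_alternative B.
  (* With a left inverse, every row [y] is the image under [f] of the row y X, so the cokernel [M]
     would be zero. *)
  case: sM => [[x x0] _]; case/eqP: x0; have [y <-] := gsurj x; apply/gker.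
  exists (\row_i \sum_j y 0 j * X j i); apply/rowP => j; rewrite fE.
  under eq_bigr => i _ do rewrite mxE mulr_suml.
  rewrite exchange_big /= (bigD1 j) //= [X in _ + X]big1 ?addr0 => [|k kj].
    under eq_bigr => i _ do rewrite -mulrA.
    by rewrite -mulr_sumr XB eqxx mulr1.
  under eq_bigr => i _ do rewrite -mulrA.
  by rewrite -mulr_sumr XB (negPf kj) mulr0.
exists a; apply: isomorphic_sym.
pose H (y : 'rV[D]_r) : Umod (point_ideal a) := \sum_j y 0 j *: v j.
have Hlin : linear H.
  move=> c y y'; rewrite /H scaler_sumr -big_split; apply: eq_bigr => j _.
  by rewrite !mxE scalerDl scalerA.
have [y gy|k kE] := linear_factor (h := HB.pack_for {linear 'rV[D]_r -> Umod (point_ideal a)} H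
    (GRing.isLinear.Build D _ _ *:%R H Hlin)) gsurj.
  have /gker[w ->] := gy; rewrite /= /H.
  under eq_bigr => j _ do rewrite fE scaler_suml.
  rewrite exchange_big big1 // => i _ /=.
  by under eq_bigr => j _ do rewrite -scalerA; rewrite -scaler_sumr Bv scaler0.
exists k; apply: simple_bijective => //; first exact: (U_simple hp).
exists (g (delta_mx 0 j0)); rewrite kE /= /H (bigD1 j0) //= big1 => [|j jj0].
  by rewrite addr0 mxE !eqxx scale1r.
by rewrite mxE (negPf jj0) andbF scale0r.
Qed.

End FinitelyPresented.

(** * Dimensions and multiplicity *)

Section DimensionTheory.
Variables (K : fieldType) (V : lmodType K).

Definition free_family (d : nat) (v : 'I_d -> V) : Prop :=
  forall c : 'I_d -> K, \sum_i c i *: v i = 0 -> forall i, c i = 0.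

Lemma lin_indep_free d (v : 'I_d -> V) : lin_indep setT v <-> free_family v.
Proof.
split=> [vP c c0 i|vP s c uniq_s _ s0 i si].
  exact: (vP (index_enum _) c (index_enum_uniq _) (fun _ _ => Logic.I) c0 i (mem_index_enum i)).
have : \sum_j (if j \in s then c j else 0) *: v j = 0.
  rewrite -[RHS]s0 [RHS]big_uniq // [RHS]big_mkcond; apply: eq_bigr => j _ /=.
  by case: ifP; rewrite ?scale0r.
by move/vP/(_ i); rewrite si.
Qed.

Lemma span_familyP d (v : 'I_d -> V) x :
  Defs.span (v @` setT) x <-> exists c : 'I_d -> K, x = \sum_i c i *: v i.
Proof. by rewrite -span_finP; split=> /span_predP. Qed.

Lemma free_family_le d d' (v : 'I_d -> V) (w : 'I_d' -> V) :
  (forall i, Defs.span (v @` setT) (w i)) -> free_family w -> (d' <= d)%N.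
Proof.
move=> wv wfree.
have /choice[A AE] : forall i, exists c : 'I_d -> K, w i = \sum_j c j *: v j.
  by move=> i; apply/span_familyP.
rewrite leqNgt; apply/negP => lt_dd'.
pose B : 'M_(d', d) := \matrix_(i, j) A i j.
have [u [uB u0]] : exists u : 'rV_d', u *m B = 0 /\ u != 0.
  have /rowV0Pn[u /sub_kermxP uB u0] : kermx B != 0.
    rewrite -mxrank_eq0 mxrank_ker subn_eq0 -ltnNge.
    exact: leq_ltn_trans (rank_leq_col B) lt_dd'.
  by exists u.
case/eqP: u0; apply/rowP => i; rewrite mxE; apply: (wfree (fun i => u 0 i)).
under eq_bigr => j _ do rewrite AE scaler_sumr.
rewrite exchange_big big1 // => k _ /=.
have := congr1 (fun C : 'rV_d => C 0 k) uB; rewrite !mxE => uBk.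
under eq_bigr => j _ do rewrite scalerA.
rewrite -scaler_suml; suff -> : \sum_j u 0 j * A j k = 0 by rewrite scale0r.
by rewrite -[RHS]uBk; apply: eq_bigr => j _; rewrite !mxE.
Qed.

Lemma mem_family d (v : 'I_d -> V) i : Defs.span (v @` setT) (v i).
Proof. by apply/span_predP/mem_span; exists i. Qed.

Lemma has_dim_mono (S S' : set V) d d' : has_dim S d -> has_dim S' d' ->
  S `<=` S' -> (d <= d')%N.
Proof.
case=> [v [/lin_indep_free vfree ->]] [w [_ ->]] sub.
by apply: (free_family_le (v := w)) vfree => i; apply: sub; apply: mem_family.
Qed.

Lemma dim_eq (S : set V) d : has_dim S d -> Defs.dim S = d.
Proof.
move=> Sd; apply/eqP; have Sdim := xgetPex 0%N (ex_intro (has_dim S) d Sd).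
by rewrite eqn_leq (has_dim_mono Sdim Sd) // (has_dim_mono Sd Sdim).
Qed.

Lemma has_dim_free (I : finType) (v : I -> V) :
  (forall c : I -> K, \sum_i c i *: v i = 0 -> forall i, c i = 0) ->
  has_dim (Defs.span (range v)) #|I|.
Proof.
move=> vfree; exists (fun i => v (enum_val i)); split.
  apply/lin_indep_free => c c0 i.
  rewrite -[i]enum_valK; apply: (vfree (fun j => c (enum_rank j))).
  rewrite -[RHS]c0 (reindex enum_rank) /=; last by apply: onW_bij; exact: enum_rank_bij.
  by apply: eq_bigr => j _; rewrite enum_rankK.
apply: (congr1 (@Defs.span K V)); apply/seteqP; split=> _ [i _ <-].
  by exists (enum_rank i); rewrite ?enum_rankK.
by exists (enum_val i).
Qed.

(** Free families inside the subspace have length at most [e]; one of maximal length spans. This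
    existence is needed because [dim] returns a junk value where no dimension exists. *)
Lemma has_dim_subspace (X : set V) (S' : set V) e : has_dim S' e ->
  Defs.span X `<=` S' -> exists d, has_dim (Defs.span X) d.
Proof.
case=> [w [_ S'E]] sub.
pose good d := `[< exists v : 'I_d -> V, free_family v /\ forall i, Defs.span X (v i) >].
have good0 : exists d, good d.
  by exists 0%N; apply/asboolP; exists (fun=> 0); split=> [? ? []|[]].
have good_le d : good d -> (d <= e)%N.
  case/asboolP=> v [vfree vX]; apply: (free_family_le (v := w)) vfree => i.
  by rewrite -S'E; apply: sub.
case: (ex_maxnP good0 good_le) => d /asboolP[v [vfree vX]] dmax.
exists d, v; split; first exact/lin_indep_free.
apply/seteqP; split=> x; last first.
  move=> /span_familyP[c ->]; apply/span_predP/rpred_sum => i _.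
  by apply/rpredZ/span_predP.
move=> Xx; apply: contrapT => xv.
suff /dmax : good d.+1 by rewrite ltnn.
pose v' (k : 'I_d.+1) := if unlift ord_max k is Some j then v j else x.
have vl j : v' (widen_ord (leqnSn d) j) = v j.
  have -> : widen_ord (leqnSn d) j = fintype.lift ord_max j.
    by apply: val_inj; rewrite /= /bump leqNgt ltn_ord.
  by rewrite /v' liftK.
have vm : v' ord_max = x by rewrite /v' unlift_none.
apply/asboolP; exists v'; split=> [c|k]; last first.
  by rewrite /v'; case: (unlift _ k) => [j|//]; apply: vX.
rewrite big_ord_recr /= vm => c0.
have cm : c ord_max = 0.
  apply/eqP; apply: contraT => cm; case: xv; apply/span_familyP.
  exists (fun j => - (c ord_max)^-1 * c (widen_ord (leqnSn d) j)).
  apply: (scalerI cm); rewrite scaler_sumr.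
  have /eqP := c0; rewrite addrC addr_eq0 => /eqP ->; rewrite -sumrN.
  apply: eq_bigr => j _.
  by rewrite vl scalerA mulrA mulrN mulfV // mulN1r scaleNr.
rewrite cm scale0r addr0 in c0.
have cw : forall j, c (widen_ord (leqnSn d) j) = 0.
  apply: vfree; rewrite -[RHS]c0; apply: eq_bigr => j _; by rewrite vl.
move=> k; case: (unliftP ord_max k) => [j ->|->] //.
rewrite -(cw j); congr (c _); apply: val_inj.
by rewrite /= /bump leqNgt ltn_ord.
Qed.

End DimensionTheory.

(** * Binomial counts, generating series and growth estimates *)

Lemma card_bmultinom (n k : nat) : #|{: 'X_{1..n < k.+1}}| = 'C(k + n, n).
Proof.
rewrite addnC -card_partial_ord_partitions -cardsT.
pose f (m : 'X_{1..n < k.+1}) : n.-tuple 'I_k.+1 := [tuple inord (m i) | i < n].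
have le_k (m : 'X_{1..n < k.+1}) i : (m i < k.+1)%N.
  by apply: leq_ltn_trans (valP m); rewrite /= mdegE (bigD1 i) //= leq_addr.
have finj : injective f.
  move=> m m' mm'; apply: val_inj; apply/mnmP => i /=.
  have := congr1 (fun t : n.-tuple 'I_k.+1 => tnth t i : nat) mm'.
  by rewrite !tnth_mktuple !inordK.
rewrite -(card_imset _ finj); congr #|pred_of_set _|; apply/setP => t; rewrite inE.
apply/imsetP/idP => [[m _ ->]|le_t].
  rewrite big_tuple (eq_bigr (fun i => m i : nat)) => [|i _]; last first.
    by rewrite tnth_mktuple inordK.
  by rewrite -mdegE -ltnS; exact: valP m.
have lt_m : (mdeg [multinom nat_of_ord (tnth t i) | i < n] < k.+1)%N.
  rewrite mdegE ltnS (leq_trans _ le_t) // big_tuple.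
  by under eq_bigr => i _ do rewrite mnmE.
exists (BMultinom lt_m) => //; apply: eq_from_tnth => i.
by apply: val_inj; rewrite tnth_mktuple /= mnmE inord_val.
Qed.

(** A factor 1 - w moves from the polynomial to the sequence as a backward difference. On the
    binomial sequence, Pascal's rule turns this difference into the case of one variable less. *)
Lemma series_mul_diff (f : nat -> int) (r : {poly int}) k :
  series_mul f (series_of_poly ((1 - 'X) * r)) k =
  series_mul (fun i => if i is j.+1 then f i - f j else f 0%N) (series_of_poly r) k.
Proof.
rewrite /series_mul /series_of_poly.
under eq_bigr => i _ do rewrite mulrBl mul1r coefB coefXM mulrBr.
rewrite sumrB [X in _ - X]big_ord_recr /= subnn mulr0 addr0.
rewrite [RHS]big_ord_recl [X in X - _]big_ord_recl /=.
under [X in _ = _ + X]eq_bigr => i _ do rewrite mulrBl.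
rewrite sumrB -addrA; congr (_ + (_ - _)); apply: eq_bigr => i _ /=.
by rewrite subn_eq0 leqNgt ltn_ord /= subnS.
Qed.

Lemma series_binomial n :
  series_eq_inv (fun i => 'C(i + n, n)%:Z) ((1 - 'X) ^+ n.+1).
Proof.
move=> k; elim: n => [|n IHn].
  rewrite expr1 -[1 - 'X]mulr1 series_mul_diff /series_mul.
  rewrite big_ord_recl big1 => [|i _]; last by rewrite lift0 /= !bin0 subrr mul0r.
  by rewrite addr0 /= /series_of_poly subn0 coef1 mul1r.
rewrite exprS series_mul_diff -IHn; apply: eq_bigr => -[[|i] lt_i] _ /=.
  by rewrite !add0n !binn.
congr (_ * _); rewrite !addnS !addSn binS PoszD.
by rewrite [_ + _ - _]addrAC subrr add0r.
Qed.

Lemma binomial_poly n : exists q : {poly rat}, forall i : nat, 'C(i + n, n)%:R = q.[i%:R].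
Proof.
exists ((n`!%:R)^-1 *: \prod_(l < n) ('X + ((n - l)%N%:R)%:P)) => i.
rewrite hornerZ horner_prod; under eq_bigr => l _.
  rewrite hornerD hornerX hornerC -natrD.
  over.
rewrite -natr_prod.
have -> : (\prod_(l < n) (i + (n - l)) = 'C(i + n, n) * n`!)%N.
  rewrite bin_ffact ffact_prod; apply: eq_bigr => l _.
  by rewrite addnBA // ltnW.
by rewrite natrM mulrCA mulVf ?mulr1 // pnatr_eq0 -lt0n fact_gt0.
Qed.

(** The inequality (1 + c/i)^n <= 1 + 3^n c/i with denominators cleared. Each step creates three
    error terms, all at most 3^n c i, hence the base 3. *)
Lemma expn_add_bound n c i : (c <= i)%N -> ((i + c) ^ n * i <= i ^ n * (i + 3 ^ n * c))%N.
Proof.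
move=> le_ci; elim: n => [|n IHn]; first by rewrite !expn0 !mul1n leq_addr.
have t_gt0 : (0 < 3 ^ n)%N by rewrite expn_gt0.
have step : ((i + c) * (i + 3 ^ n * c) <= i * (i + 3 ^ n.+1 * c))%N.
  have h1 : (3 ^ n * c * c <= 3 ^ n * c * i)%N by rewrite leq_mul2l le_ci orbT.
  have h2 : (c * i <= 3 ^ n * (c * i))%N by rewrite leq_pmull.
  by rewrite expnS; move: (3 ^ n)%N h1 h2 => t h1 h2; lia.
rewrite !expnS -!mulnA (leq_trans (leq_mul (leqnn _) IHn)) //.
rewrite expnS -mulnA in step.
by rewrite mulnCA [X in (_ <= X)%N]mulnCA leq_mul.
Qed.

(** Bernoulli's inequality (1 - c/i)^n >= 1 - n c/i, with denominators cleared. *)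
Lemma expn_sub_bound n c i : (c <= i)%N -> (i ^ n * i <= (i - c) ^ n * i + n * c * i ^ n)%N.
Proof.
move=> le_ci; elim: n => [|n IHn]; first by rewrite !expn0 !mul1n leq_addr.
have le_jn : ((i - c) ^ n <= i ^ n)%N by case: n {IHn} => // n; rewrite leq_exp2r // leq_subr.
rewrite !expnS; move: (i ^ n)%N ((i - c) ^ n)%N IHn le_jn => x y IHn le_yx.
have h1 : (i * (x * i) <= i * (y * i + n * c * x))%N by rewrite leq_mul2l IHn orbT.
have h2 : (c * (y * i) <= c * (x * i))%N by rewrite !leq_mul2l leq_mul2r le_yx !orbT.
have h3 : (i * (y * i) = (i - c) * (y * i) + c * (y * i))%N by rewrite -mulnDl subnK.
by move: (i - c)%N h3 => j h3; lia.
Qed.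

Lemma rat_growth n c (d : nat -> nat) :
  (forall i, (c <= i)%N -> ((i - c) ^ n <= d i * n`! <= (i + c) ^ n)%N) ->
  forall eps : rat, 0 < eps -> exists N : nat, forall i : nat, (N <= i)%N ->
    `|(d i)%:R - 1 / n`!%:R * i%:R ^+ n| <= eps * i%:R ^+ n.
Proof.
move=> dP eps eps0.
pose A := (3 ^ n * c + n * c)%N.
(* From this bound on, [A <= eps * i], where [A] dominates the error constants on both sides; the
   summand [c] and the successor ensure [c <= i] and [0 < i]. *)
exists (Num.bound (A%:R / eps) + c)%N.+1 => i lt_Ni.
have le_ci : (c <= i)%N by apply: leq_trans (leq_addl _ _) (ltnW lt_Ni).
have i0 : 0 < i%:R :> rat by rewrite ltr0n (leq_trans _ lt_Ni).
have le_A : A%:R <= eps * i%:R.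
  rewrite mulrC -ler_pdivrMr //; apply: ltW.
  have := archi_boundP (divr_ge0 (ler0n rat A) (ltW eps0)) => /lt_le_trans -> //.
  by rewrite ler_nat (leq_trans _ (ltnW lt_Ni)) // leq_addr.
have f1 : 1 <= n`!%:R :> rat by rewrite ler1n fact_gt0.
have f0 : 0 < n`!%:R :> rat by apply: lt_le_trans f1.
have x0 : 0 <= i%:R ^+ n :> rat by rewrite exprn_ge0 // ltW.
have [/andP[lo hi] add sub] := And3 (dP i le_ci) (expn_add_bound n le_ci) (expn_sub_bound n le_ci).
have hi' : (d i)%:R * n`!%:R <= (1 + eps) * i%:R ^+ n :> rat.
  rewrite -natrM; apply: (@le_trans _ _ ((i + c)%N%:R ^+ n)); first by rewrite -natrX ler_nat.
  rewrite -(ler_pM2r i0); apply: (@le_trans _ _ (i%:R ^+ n * (i%:R + A%:R))).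
    rewrite -natrX -natrD -!natrX -!natrM ler_nat (leq_trans add) // leq_mul2l leq_add2l.
    by rewrite leq_addr orbT.
  by rewrite mulrC -mulrA [_ * i%:R]mulrC mulrA ler_wpM2r // mulrDl mul1r lerD2l.
have lo' : (1 - eps) * i%:R ^+ n <= (d i)%:R * n`!%:R :> rat.
  rewrite -natrM; apply: (@le_trans _ _ ((i - c)%N%:R ^+ n)); last by rewrite -natrX ler_nat.
  rewrite -(ler_pM2r i0) mulrBl mul1r mulrBl lerBlDr.
  apply: (@le_trans _ _ ((i - c)%N%:R ^+ n * i%:R + A%:R * i%:R ^+ n)).
    rewrite -!natrX -!natrM -natrD ler_nat (leq_trans sub) // leq_add2l leq_mul2r.
    by rewrite leq_addl orbT.
  by rewrite lerD2l mulrAC ler_wpM2r // .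
rewrite ler_norml; apply/andP; split.
  rewrite lerBrDr addrC -[1 / _ * _ - _]/(1 / _ * _ + - _) -mulNr -mulrDl mul1r.
  rewrite -(ler_pM2r f0); apply: le_trans lo'.
  rewrite mulrAC ler_wpM2r // mulrDl mulVf ?gt_eqF // lerD2l mulNr lerN2.
  by rewrite ler_peMr // ltW.
rewrite lerBlDr -mulrDl -(ler_pM2r f0); apply: le_trans hi' _.
rewrite mulrAC ler_wpM2r // mulrDl mul1r mulVf ?gt_eqF // addrC lerD2r.
by rewrite ler_peMr // ltW.
Qed.

(** * Multiplicity for an arbitrary generating subspace *)

Section Multiplicity.
Variables (K : closedFieldType) (p : nat) (hp : p \in [pchar K]) (n : nat).
Variable a : 'I_n -> K.
Local Notation P := {mpoly K[n]}.
Local Notation D := (diffops {mpoly K[n]}).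
Local Notation m := (point_ideal a).
Local Notation U := (Umod m).
Local Notation delta := (Ubar1 m).
Local Notation mul f := (@mul_diffop K P f).
Local Notation cst c := (constD K n c).

Lemma Uspan_has_dim k : has_dim (V := Kspace U)
  (Defs.span (range (fun b : 'X_{1..n < k.+1} => Ubasis a b : Kspace U))) 'C(k + n, n).
Proof. by rewrite -card_bmultinom; apply: has_dim_free; exact: (Ubasis_free hp). Qed.

Lemma Ufilt_has_dim i : has_dim (V := Kspace U) (Ufilt m i) 'C(i + n, n).
Proof.
rewrite (_ : Ufilt m i = Defs.span (range (fun b : 'X_{1..n < i.+1} => Ubasis a b : Kspace U))).
  exact: Uspan_has_dim.
by apply/seteqP; split=> u; [move/Ufilt_Uspan/span_predP | move/span_predP/Ufilt_Uspan].
Qed.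

Lemma Kdim_Ufilt i : Kdim (Ufilt m i) = 'C(i + n, n).
Proof. exact: dim_eq (Ufilt_has_dim i). Qed.

Definition canon_pred (i : nat) : {pred Kspace D^o} :=
  span_pred (V := Kspace D^o)
    [set d | exists a b : 'X_{1..n}, (mdeg a + mdeg b <= i)%N /\ d = xmon K a * dpows K b].
HB.instance Definition _ i := GRing.SubmodClosed.on (canon_pred i).

Lemma canon_filtrationP i (d : D) : canon_filtration i d <-> (d : Kspace D^o) \in canon_pred i.
Proof. by split=> /span_predP. Qed.

Lemma canon_pred_mono i j (d : D) : (i <= j)%N ->
  (d : Kspace D^o) \in canon_pred i -> (d : Kspace D^o) \in canon_pred j.
Proof.
move=> le_ij; apply: (@span_subset _ (Kspace D^o) _ (canon_pred j)) => _ [b [c [le_i ->]]].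
by apply: mem_span; exists b, c; split=> //; apply: leq_trans le_ij.
Qed.

(** Bringing the variable to the left of the divided powers adds one variable, plus a correction
    term with one divided power fewer. *)
Lemma canon_pred_mulX i (d : D) (l : 'I_n) : (d : Kspace D^o) \in canon_pred i ->
  (d * mul 'X_l : Kspace D^o) \in canon_pred i.+1.
Proof.
case/span_predP=> r [c [x [Xx ->]]].
rewrite (_ : _ * _ = \sum_(j < r) c j *: ((x j : D) * mul 'X_l : Kspace D^o)); last first.
  by rewrite mulr_suml; apply: eq_bigr => j _; rewrite -[in LHS]mulrA.
apply: rpred_sum => j _; apply: rpredZ.
have [b [e [le_i ->]]] := Xx j; rewrite -mulrA dpows_var mulrDr.
apply: (@rpredD (Kspace D^o)).
  rewrite mulrA; apply: mem_span; exists (b + U_(l))%MM, e; split.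
    by rewrite mdegD mdeg1 addn1 addSn ltnS.
  by rewrite /xmon mpolyXD rmorphM.
case: eqP => _; first by rewrite mulr0; apply: (@rpred0 (Kspace D^o)).
apply: mem_span; exists b, (e - U_(l))%MM; split=> //.
by rewrite (leq_trans _ (leqW le_i)) // leq_add2l mdegB.
Qed.

Lemma canon_pred_mulXm i (d : D) (b : 'X_{1..n}) : (d : Kspace D^o) \in canon_pred i ->
  (d * mul 'X_[b] : Kspace D^o) \in canon_pred (i + mdeg b).
Proof.
elim/mnm_add_ind: b i d => [|l b IHb] i d di.
  by rewrite mpolyX0 rmorph1 mulr1 mdeg0 addn0.
rewrite mpolyXD rmorphM mulrA mdegD mdeg1 add1n addnS -addSn.
exact/IHb/canon_pred_mulX.
Qed.

Lemma canon_pred_mul i (d : D) (f : P) : (d : Kspace D^o) \in canon_pred i ->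
  (d * mul f : Kspace D^o) \in canon_pred (i + msize f).
Proof.
move=> di; rewrite {1}[f]mpolyE raddf_sum mulr_sumr big_seq; apply: (@rpred_sum (Kspace D^o)) => b fb.
rewrite /= -mul_mpolyC rmorphM /= mul_constE mulrA -constD_comm -mulrA.
apply: (@rpredZ _ (Kspace D^o)).
apply: canon_pred_mono (canon_pred_mulXm b di).
by rewrite leq_add2l ltnW // msize_mdeg_lt.
Qed.

Lemma canon_dpows b : (dpows K b : Kspace D^o) \in canon_pred (mdeg b).
Proof.
by apply: mem_span; exists 0%MM, b; rewrite mdeg0 /xmon mpolyX0 rmorph1 mul1r.
Qed.

(** Finitely many spanning vectors have bounded degree [t], and an operator in the i-th step raises
    degrees by at most [i]. *)
Lemma filt_upper (M0 : set U) : fin_dim M0 -> exists t, forall i u,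
  filt M0 i u -> (u : Kspace U) \in Uspan a (i + t).
Proof.
case=> r [v [_ M0E]].
have /choice[k vk] : forall j, exists k, (v j : Kspace U) \in Uspan a k.
  by move=> j; apply: (Uspan_exhaust hp).
exists (\max_j k j) => i u /span_predP.
apply: (@span_subset _ (Kspace U) _ (Uspan a (i + \max_j k j))) => _ [d [w [di M0w ->]]].
have wt : (w : Kspace U) \in Uspan a (\max_j k j).
  move: M0w; rewrite M0E => /span_predP.
  apply: (@span_subset _ (Kspace U) _ (Uspan a (\max_j k j))) => _ [j _ <-].
  exact: Uspan_mono (leq_bigmax j) (vk j).
case: di => s [c [x [Xx ->]]].
rewrite scaler_suml; apply: (@rpred_sum (Kspace U)) => j _.
rewrite -scalerA; apply: (@rpredZ _ (Kspace U)).
have [e [b [le_i ->]]] := Xx j; rewrite -scalerA; apply: Uspan_mul.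
apply: Uspan_mono (Uspan_dpows b wt).
by rewrite leq_add2r (leq_trans (leq_addl _ _) le_i).
Qed.

(** Some nonzero vector of [M0] is carried to a multiple of delta by a fixed polynomial. From there
    all divided powers are available, at the cost of a shift by the size of that polynomial. *)
Lemma filt_lower (M0 : set U) : Defs.span (V := U) M0 = setT -> exists s, forall i u,
  (s <= i)%N -> (u : Kspace U) \in Uspan a (i - s).+1 -> filt M0 i u.
Proof.
move=> M0T.
have [u [M0u u0]] : exists u, M0 u /\ u != 0.
  apply: contrapT => no; have : Defs.span (V := U) M0 delta by rewrite M0T.
  case=> r [c [x [M0x dE]]]; have /eqP := delta_neq0 hp a; apply; rewrite dE.
  rewrite big1 // => i _; suff -> : x i = 0 by rewrite scaler0.
  by apply: contrapT => /eqP xi; apply: no; exists (x i).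
have [b [c [c0 E _]]] := U_lead hp u0.
exists (msize (shiftmon a b)) => i w le_si wi; apply/(span_predP (V := Kspace U)).
move: w wi; apply: span_subset => _ [b1 _ <-].
have -> : Ubasis a b1 = c^-1 *: ((dpows K b1 * mul (shiftmon a b)) *: u : Kspace U).
  rewrite scale_cst -scalerA E !scalerA constD_comm -mulrA -(rmorphM (constD K n)).
  by rewrite mulVf // (rmorph1 (constD K n)) mulr1.
apply: rpredZ; apply: mem_span; exists (dpows K b1 * mul (shiftmon a b)), u; split=> //.
apply/canon_filtrationP; apply: canon_pred_mono (canon_pred_mul _ (canon_dpows b1)).
by rewrite addnC -leq_subRL // -ltnS; exact: valP b1.
Qed.

Lemma fin_dim_Ufilt0 : fd_generating (Ufilt m 0).
Proof.
split; first by exists 'C(0 + n, n); exact: Ufilt_has_dim.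
apply/seteqP; split=> // u _; have [d ->] := delta_gen u.
apply/span_predP/rpredZ/mem_span/Ufilt_Uspan.
have -> : delta = Ubasis a 0%MM by rewrite /Ubasis dpows0 scale1r.
by apply: Ubasis_Uspan; rewrite mdeg0.
Qed.

Lemma bin_fact_bounds i : (i ^ n <= 'C(i + n, n) * n`! <= (i + n) ^ n)%N.
Proof.
have E c : (c ^ n = \prod_(l < n) c)%N by rewrite prod_nat_const card_ord.
rewrite bin_ffact ffact_prod !E.
apply/andP; split; apply: leq_prod => l _; last exact: leq_subr.
by rewrite -addnBA ?leq_addr // ltnW.
Qed.

Lemma U_multiplicity : is_multiplicity U 1.
Proof.
split; first by exists (Ufilt m 0); exact: fin_dim_Ufilt0.
move=> M0 [fdM0 genM0].
have [t upper] := filt_upper fdM0; have [s lower] := filt_lower genM0.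
(* One constant must serve both sides: the dimension times n! lies between (i - s)^n and (i + t +
   n)^n. *)
apply: (@rat_growth n (s + t + n) (fun i => Kdim (filt M0 i))) => i le_i.
have le_si : (s <= i)%N by apply: leq_trans le_i; rewrite -addnA leq_addr.
have sub2 : filt M0 i `<=` Defs.span (range (fun b : 'X_{1..n < (i + t).+1} => Ubasis a b : Kspace U)).
  by move=> u /upper ut; apply/span_predP; exact: Uspan_mono (leqnSn _) ut.
have [d dE] := has_dim_subspace (Uspan_has_dim (i + t)) sub2.
rewrite /Kdim (dim_eq dE).
have sub1 : Defs.span (range (fun b : 'X_{1..n < (i - s).+1} => Ubasis a b : Kspace U)) `<=` filt M0 i.
  by move=> u /span_predP; exact: lower.
have le1 := has_dim_mono (Uspan_has_dim (i - s)) dE sub1.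
have le2 := has_dim_mono dE (Uspan_has_dim (i + t)) sub2.
have /andP[lo _] := bin_fact_bounds (i - s); have /andP[_ hi] := bin_fact_bounds (i + t).
have leX x y : (x <= y)%N -> (x ^ n <= y ^ n)%N.
  by move=> le_xy; case: (n) => // n'; rewrite leq_exp2r.
apply/andP; split.
  apply: leq_trans (leX _ _ _) (leq_trans lo _); last by rewrite leq_mul2r le1 orbT.
  by rewrite leq_sub2l // -addnA leq_addr.
apply: leq_trans (leq_trans _ hi) (leX _ _ _); first by rewrite leq_mul2r le2 orbT.
by rewrite -!addnA leq_add2l leq_addl.
Qed.

End Multiplicity.

Lemma isomorphic_assP (K : fieldType) (n : nat) (M N : lmodType (diffops {mpoly K[n]})) :
  isomorphic M N -> assP M = assP N.
Proof.
have sub (M' N' : lmodType (diffops {mpoly K[n]})) : isomorphic M' N' -> assP M' `<=` assP N'.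
  case=> f fbij I [Ip [x xI]]; split=> //; exists (f x) => g; rewrite xI.
  rewrite -[g *: (f x : restr _ _)]/(mul_diffop g *: f x) -linearZZ.
  split=> [gx|/eqP]; last by rewrite -(linear0 f) (inj_eq (bij_inj fbij)) => /eqP.
  by rewrite [mul_diffop g *: x]gx linear0.
by move=> MN; apply/seteqP; split; apply: sub => //; apply: isomorphic_sym.
Qed.

Theorem corollary6p8 (K : closedFieldType) (p : nat) (hp : p \in [pchar K])
    (n : nat) (hn : (0 < n)%N) :
  (* 1 *)
  [/\ bijection_between setT (@maximal_idealr {mpoly K[n]})
        (@point_ideal K n),
      bijection_between (@maximal_idealr {mpoly K[n]})
        (@simple_fp_class (diffops {mpoly K[n]}))
        (fun m => isoclass (Umod m)),
      forall M : lmodType (diffops {mpoly K[n]}),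
        simple_module M -> finitely_presented M ->
        exists m, [/\ maximal_idealr m, assP M = [set m]
                    & isoclass (Umod m) = isoclass M]
    & forall m : idealr {mpoly K[n]}, maximal_idealr m ->
        assP (Umod m) = [set m]] /\
  (forall m : idealr {mpoly K[n]}, maximal_idealr m ->
  (* 2 *)
  [/\ exists phi : {rmorphism K -> endo (Umod m)},
        bijective phi /\ forall c u, phi c u = constD K n c *: u,
  (* 3 *)
      exists f : {additive LambdaTensor m -> Umod m},
        bijective f /\
        forall (l : Lambda K n) (q : residue m),
          f (LambdaTens l q) = Utens (Lambda_diffop l) q,
      forall u : Umod m, exists l : Lambda K n,
        u = Lambda_diffop l *: Ubar1 m,
      forall i : nat,
        basis_on (V := Kspace (Umod m)) [set b : 'X_{1..n} | (mdeg b <= i)%N]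
          (fun b => dpows K b *: Ubar1 m) (Ufilt m i)
    & [/\ series_eq_inv (fun i => (Kdim (Ufilt m i))%:Z) ((1 - 'X) ^+ n.+1),
          is_multiplicity (Umod m) 1,
          forall i : nat, Kdim (Ufilt m i) = 'C(i + n, n)
        & exists q : {poly rat}, forall i : nat,
            (Kdim (Ufilt m i))%:R = q.[i%:R]]]).
Proof.
have cls (m : idealr {mpoly K[n]}) : maximal_idealr m -> simple_fp_class (isoclass (Umod m)).
  case/maximal_point_ideal=> a ->; exists (Umod (point_ideal a)); split=> //.
    exact: (U_simple hp).
  exact: U_fp.
have assU (m : idealr {mpoly K[n]}) : maximal_idealr m -> assP (Umod m) = [set m].
  by case/maximal_point_ideal=> a ->; exact: (U_ass hp).
have fp (M : lmodType (diffops {mpoly K[n]})) : simple_module M -> finitely_presented M ->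
    exists m, [/\ maximal_idealr m, assP M = [set m] & isoclass (Umod m) = isoclass M].
  move=> sM fM; have [a UM] := simple_fp_point hp sM fM.
  have max_a : maximal_idealr (point_ideal a) by exact: point_ideal_maximal.
  exists (point_ideal a); split=> //; last exact: isoclass_eq.
  by rewrite -(isomorphic_assP UM) assU.
split.
  split=> //.
  - split=> [a _|a b _ _|m /maximal_point_ideal [a ->]].
    + exact: point_ideal_maximal.
    + exact: point_ideal_inj.
    + by exists a.
  (* Injectivity holds because the associated primes are an isomorphism invariant and recover the
     maximal ideal. *)
  - split=> // [m m' max_m max_m' /isoclass_inj/isomorphic_assP|C [M [sM fM ->]]].
      by rewrite !assU // => E; have : [set m] m by []; rewrite E.
    by have [m [max_m _ E]] := fp M sM fM; exists m.
move=> m /maximal_point_ideal [a ->].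
split.
- exact: (U_endo hp).
- exact: (U_LambdaTensor hp).
- exact: (U_Lambda hp).
- exact: (U_basis_on hp).
- have dimU i : Kdim (Ufilt (point_ideal a) i) = 'C(i + n, n) by exact: (Kdim_Ufilt hp).
  split=> //.
  + move=> k; rewrite -(series_binomial n k); apply: eq_bigr => i _.
    by rewrite dimU.
  + exact: (U_multiplicity hp).
  + by have [q qE] := binomial_poly n; exists q => i; rewrite dimU.
Qed.
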